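(* Let $H=\langle X\rangle$ be a group with countable (enumerated) generating set $X=\{x_1,x_2,\ldots\}$. Then there exists an embedding $\Phi_X:H\hookrightarrow G$ into a two-generated group $G=\langle f,s\rangle$ such that the following hold. (a) There exists a computable map $i\mapsto w_i\in\{f^{\pm1},s^{\pm1}\}^*$ such that the word $w_i$ represents the element $\Phi_X(x_i)$ in $G$ for every $i$. (b) If $H$ is a solvable group of derived length $l$, then $G$ is a solvable group of derived length $l+2$. (c) $G$ has a recursive presentation if and only if $H$ has a recursive presentation with respect to the generating set $X$. (d) $G$ has decidable word problem if and only if $H$ is computable with respect to the generating set $X$. (e) If $H$ is a computable group with respect to the generating set $X$, then the membership problem for the subgroup $\Phi_X(H)\le G$ is decidable, i.e. there exists an algorithm that for any $g\in G$ (given as a word in $f^{\pm1},s^{\pm1}$) decides whether or not $g\in\Phi_X(H)$. (f) If $H$ is left- (respectively bi-) orderable, then so is $G$, and $G$ continues the order on $H$. Moreover, if there is a left- (respectively bi-) order on $H$ that is computable with respect to the generating set $X$, then $G$ has a computable left- (respectively bi-) order that continues the order on $H$. (g) There exist $N_1,N_2\le G$ such that $\Phi_X(H)\vartriangleleft N_1\vartriangleleft N_2\vartriangleleft G$; hence $\Phi_X(H)$ is a subnormal subgroup of $G$.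
   Context: $(X\cup X^{-1})^*$ denotes the set of finite words in the formal letters $x_i^{\pm1}$; each word represents an element of $H$, and recursiveness and recursive enumerability of sets of words are understood via the indices of the letters; similarly for the words $\{f^{\pm1},s^{\pm1}\}^*$ representing elements of $G$. $H$ has a recursive presentation with respect to $X$ if $\{u\in (X\cup X^{-1})^*\mid u=_H1\}$ is recursively enumerable; $H$ is computable with respect to $X$ if this set is recursive. For the finitely generated group $G$, having a recursive presentation and having decidable word problem are the same notions taken with respect to a finite generating set (they do not depend on which one). A left-order is a linear order invariant under left multiplication; a bi-order is a linear order invariant under left and right multiplication. A group is left- (bi-) orderable if it has a left- (bi-) order. An order $\preceq$ on a group generated by $Y$ is computable with respect to $Y$ if the set of pairs of words $(u,v)$ over $Y\cup Y^{-1}$ with $u\preceq v$ is recursive; for $G$, computability is with respect to $\{f,s\}$. An order $\preceq_G$ on $G$ continues an order $\preceq_H$ on $H$ if $h\preceq_H h'$ is equivalent to $\Phi_X(h)\preceq_G\Phi_X(h')$ for all $h,h'\in H$. In (f), ''$G$ continues the order on $H$'' means: for every given left- (respectively bi-) order on $H$ there is a left- (respectively bi-) order on $G$ that continues it. *)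

(* Defs.v *)
From mathcomp Require Import all_boot.
From mathcomp Require Import boolp classical_sets.

Set Implicit Arguments.
Unset Strict Implicit.
Unset Printing Implicit Defensive.

Local Open Scope classical_set_scope.
Local Open Scope group_scope.

(** * Recursive functions, recursive and recursively enumerable sets *)

(* Kleene's general recursive functions: since [mu] is only applied where the
   search always succeeds, this class is exactly that of the total
   mu-recursive functions, and no partial functions are needed.  In
   [rec_prim] the recursion variable, and in [rec_mu] the search variable,
   is the first argument. *)
Inductive recursive_fun : forall n : nat, (n.-tuple nat -> nat) -> Prop :=
| rec_zero : recursive_fun (fun _ : 0.-tuple nat => 0%N)
| rec_succ : recursive_fun (fun v : 1.-tuple nat => (thead v).+1)
| rec_proj n (i : 'I_n) : recursive_fun (fun v : n.-tuple nat => tnth v i)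
| rec_comp m n (h : m.-tuple nat -> nat) (g : 'I_m -> n.-tuple nat -> nat) :
    recursive_fun h -> (forall i, recursive_fun (g i)) ->
    recursive_fun (fun v : n.-tuple nat => h [tuple g i v | i < m])
| rec_prim n (f : n.-tuple nat -> nat) (g : n.+2.-tuple nat -> nat)
    (h : n.+1.-tuple nat -> nat) :
    recursive_fun f -> recursive_fun g ->
    (forall v : n.-tuple nat, h [tuple of 0%N :: v] = f v) ->
    (forall (k : nat) (v : n.-tuple nat),
       h [tuple of k.+1 :: v]
         = g [tuple of k :: h [tuple of k :: v] :: v]) ->
    recursive_fun h
| rec_mu n (f : n.+1.-tuple nat -> nat) (h : n.-tuple nat -> nat) :
    recursive_fun f ->
    (forall v : n.-tuple nat, f [tuple of h v :: v] = 0%N) ->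
    (forall (v : n.-tuple nat) (k : nat),
       (k < h v)%N -> f [tuple of k :: v] <> 0%N) ->
    recursive_fun h.

(* [pickle] is used as Goedel numbering.  It is only applied below to types
   built from [nat] and [bool] by pairs and sequences, where it is the
   effective coding of finite sequences of numbers [CodeSeq.code]. *)
Definition computable (T U : countType) (f : T -> U) : Prop :=
  exists2 g : 1.-tuple nat -> nat, recursive_fun g
    & forall x : T, g [tuple pickle x] = pickle (f x).

Definition recursive_set (T : countType) (A : set T) : Prop :=
  exists2 d : T -> bool, computable d & forall x : T, A x <-> d x.

Definition re_set (T : countType) (A : set T) : Prop :=
  A = set0 \/ exists2 e : nat -> T, computable e & range e = A.

(** * Words *)

(* The letter [(i, false)] is x_i and [(i, true)] is x_i^-1. *)
Notation word I := (seq (I * bool)%type).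

Definition eval_word (G : groupType) (I : Type) (x : I -> G) (w : word I) : G :=
  \prod_(l <- w) (if l.2 then (x l.1)^-1 else x l.1).

Definition generates (G : groupType) (I : Type) (x : I -> G) : Prop :=
  range (eval_word x) = setT.

(* The two-letter alphabet {f, s} is indexed by [bool]. *)
Definition pair_gen (G : groupType) (f s : G) (b : bool) : G :=
  if b then s else f.

Definition recursively_presented (G : groupType) (I : countType) (x : I -> G)
  : Prop := re_set [set u : word I | eval_word x u = 1].

Definition computable_group (G : groupType) (I : countType) (x : I -> G)
  : Prop := recursive_set [set u : word I | eval_word x u = 1].

(** * Subgroups, derived series, normality *)

Definition subgroup (G : groupType) (A : set G) : Prop := group_closed (mem A).

Definition generated (G : groupType) (A : set G) : set G :=
  smallest (@subgroup G) A.

Definition commutator_subgroup (G : groupType) (A : set G) : set G :=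
  generated [set [~ a, b] | a in A & b in A].

Definition derived (G : groupType) (n : nat) : set G :=
  iter n (@commutator_subgroup G) setT.
Arguments derived G n : clear implicits.

Definition solvable_of_derived_length (G : groupType) (l : nat) : Prop :=
  derived G l = [set 1] /\ forall m : nat, (m < l)%N -> derived G m <> [set 1].

Definition normal_in (G : groupType) (A B : set G) : Prop :=
  [/\ subgroup A, subgroup B, A `<=` B
    & forall a b : G, A a -> B b -> A (a ^ b)].

Definition subnormal (G : groupType) (A : set G) : Prop :=
  exists (n : nat) (N : nat -> set G),
    [/\ N 0%N = A, N n = setT
      & forall i : nat, (i < n)%N -> normal_in (N i) (N i.+1)].

(** * Ordered groups *)

Definition left_order (G : groupType) (le : rel G) : Prop :=
  [/\ antisymmetric le, transitive le, total le
    & forall g x y : G, le x y -> le (g * x) (g * y)].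

Definition bi_order (G : groupType) (le : rel G) : Prop :=
  left_order le /\ forall g x y : G, le x y -> le (x * g) (y * g).

Definition left_orderable (G : groupType) : Prop :=
  exists le : rel G, left_order le.

Definition bi_orderable (G : groupType) : Prop :=
  exists le : rel G, bi_order le.

Definition computable_order (G : groupType) (I : countType) (x : I -> G)
    (le : rel G) : Prop :=
  recursive_set
    [set uv : word I * word I | le (eval_word x uv.1) (eval_word x uv.2)].

Definition continues (H G : groupType) (Phi : H -> G) (leH : rel H)
    (leG : rel G) : Prop :=
  forall h h' : H, leH h h' <-> leG (Phi h) (Phi h').

(* Main.v *)
(* Let W(A) be the group of pairs (phi, m) of a function phi : Z -> A with support
   bounded below and an integer m, a subgroup of the unrestricted wreath product
   A Wr Z.  In W(H) let t be the shift and g_i the product of t with the step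
   function that is x_i at positive integers; then [t, g_i], with suitable signs,
   is the function concentrated at 0 with value x_i.  In W(W(H)) let s be the shift
   and f the function equal to t at 1, to g_i at 2^(i+1), and trivial elsewhere.
   Two translates of f by 1 and 2^(i+1) are both nontrivial only at 0, so that their
   commutator is concentrated at 0 with value [t, g_i]; hence G = <f, s> contains
   the copy of H concentrated at (0, 0).

   Each coordinate of a word u in f, s is computed as a word in X.  Only finitely
   many coordinates matter: far to the right a window of radius |u| meets at most
   one power of 2, and the value there is a power of some g_i (or t), trivial iff
   its t-exponent is; this exponent can be read off near one large power of 2.  So
   triviality, membership in the image of H, and the position of the leftmost
   nontrivial coordinate reduce to finitely many questions about H.  Supports being
   bounded below, G is ordered by its leftmost nontrivial coordinate. *)
From HB Require Import structures.
Require Import Defs.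
From mathcomp Require Import all_boot.
From mathcomp Require Import boolp classical_sets.
From mathcomp Require Import order ssralg ssrnum ssrint zify.

Set Implicit Arguments.
Unset Strict Implicit.
Unset Printing Implicit Defensive.

Import Order.TTheory.

Local Open Scope classical_set_scope.

(** * Recursive functions of natural numbers *)

Lemma eq_recursive n (f g : n.-tuple nat -> nat) :
  f =1 g -> recursive_fun f -> recursive_fun g.
Proof. by move=> /funext ->. Qed.

Definition rec1 (g : nat -> nat) :=
  recursive_fun (fun v : 1.-tuple nat => g (tnth v ord0)).

Definition rec2 (g : nat -> nat -> nat) :=
  recursive_fun (fun v : 2.-tuple nat => g (tnth v ord0) (tnth v ord_max)).

Lemma rec1_comp n g (f : n.-tuple nat -> nat) :
  rec1 g -> recursive_fun f -> recursive_fun (fun v => g (f v)).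
Proof.
move=> gR fR; apply: (eq_recursive _ (rec_comp gR (g := fun _ => f) _)) => //.
by move=> v /=; rewrite tnth_mktuple.
Qed.

Lemma rec2_comp n g (f1 f2 : n.-tuple nat -> nat) :
  rec2 g -> recursive_fun f1 -> recursive_fun f2 ->
  recursive_fun (fun v => g (f1 v) (f2 v)).
Proof.
move=> gR f1R f2R.
apply: (eq_recursive _
  (rec_comp gR (g := fun i : 'I_2 => if i == ord0 then f1 else f2) _)).
  by move=> v /=; rewrite !tnth_mktuple.
by move=> i; case: ifP.
Qed.

Lemma rec1_succ : rec1 S.
Proof. exact: rec_succ. Qed.

Lemma recursive_const n c : recursive_fun (fun _ : n.-tuple nat => c).
Proof.
elim: c => [|c IH]; last exact: rec1_comp rec1_succ IH.
by apply: (eq_recursive _ (rec_comp rec_zero (g := fun (i : 'I_0) _ => 0) _)) => [|[]].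
Qed.

Lemma rec1_id : rec1 id. Proof. exact: rec_proj. Qed.

Lemma rec1_const c : rec1 (fun=> c). Proof. exact: recursive_const. Qed.

Lemma rec1_comp1 g f : rec1 g -> rec1 f -> rec1 (fun x => g (f x)).
Proof. exact: rec1_comp. Qed.

Lemma rec1_comp2 g f1 f2 :
  rec2 g -> rec1 f1 -> rec1 f2 -> rec1 (fun x => g (f1 x) (f2 x)).
Proof. exact: rec2_comp. Qed.

Lemma rec2_comp1 g f : rec1 g -> rec2 f -> rec2 (fun x y => g (f x y)).
Proof. exact: rec1_comp. Qed.

Lemma rec2_comp2 g f1 f2 :
  rec2 g -> rec2 f1 -> rec2 f2 -> rec2 (fun x y => g (f1 x y) (f2 x y)).
Proof. exact: rec2_comp. Qed.

Lemma rec2_const c : rec2 (fun _ _ => c). Proof. exact: recursive_const. Qed.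

Lemma rec2_fst : rec2 (fun x _ => x). Proof. exact: rec_proj. Qed.

Lemma rec2_snd : rec2 (fun _ y => y). Proof. exact: rec_proj. Qed.

(** Primitive recursion restated for [iteri], so that a function is shown recursive by writing it as
    a loop. The step receives counter, accumulator and parameter, in this order. *)
Lemma rec2_iteri (f : nat -> nat) (g : nat -> nat -> nat -> nat) :
  rec1 f ->
  recursive_fun (fun v : 3.-tuple nat =>
    g (tnth v ord0) (tnth v (inord 1)) (tnth v ord_max)) ->
  rec2 (fun k p => iteri k (fun i acc => g i acc p) (f p)).
Proof.
move=> fR gR; apply: (rec_prim fR gR).
  by move=> v; rewrite !(tnth_nth 0); case: v => [[|a []]].
by move=> k v; rewrite !(tnth_nth 0) inordK //; case: v => [[|a []]].
Qed.

Lemma rec2_iteri_acc (f : nat -> nat) (g : nat -> nat -> nat) :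
  rec1 f -> rec2 g -> rec2 (fun k p => iteri k (fun i acc => g i acc) (f p)).
Proof.
move=> fR gR; apply: (rec2_iteri (g := fun i acc p => g i acc)) => //.
exact: rec2_comp gR (rec_proj _) (rec_proj _).
Qed.

Lemma rec1_iteri c (g : nat -> nat -> nat) :
  rec2 g -> rec1 (fun k => iteri k (fun i acc => g i acc) c).
Proof.
move=> gR.
exact: rec1_comp2 (rec2_iteri_acc (rec1_const c) gR) rec1_id rec1_id.
Qed.

Lemma rec1_pred : rec1 predn.
Proof.
have -> : predn = fun k => iteri k (fun i acc => i) 0 by apply/funext; case.
exact: rec1_iteri rec2_fst.
Qed.

Lemma rec2_add : rec2 addn.
Proof.
have -> : addn = fun k p => iteri k (fun i acc => acc.+1) p.
  by apply/funext => k; apply/funext => p; elim: k => //= k <-.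
exact: rec2_iteri_acc rec1_id (rec2_comp1 rec1_succ rec2_snd).
Qed.

Lemma rec2_sub : rec2 subn.
Proof.
have R : rec2 (fun k p => iteri k (fun i acc => acc.-1) p).
  exact: rec2_iteri_acc rec1_id (rec2_comp1 rec1_pred rec2_snd).
have -> : subn = fun p k => iteri k (fun i acc => acc.-1) p.
  by apply/funext => p; apply/funext => k; elim: k => [|k /= <-]; rewrite ?subn0 ?subnS.
exact: rec2_comp2 R rec2_snd rec2_fst.
Qed.

Lemma rec1_expn2 : rec1 (expn 2).
Proof.
have -> : expn 2 = fun k => iteri k (fun i acc => acc + acc) 1.
  by apply/funext; elim=> //= k <-; rewrite expnS mul2n addnn.
exact: rec1_iteri (rec2_comp2 rec2_add rec2_snd rec2_snd).
Qed.

Lemma rec2_mul : rec2 muln.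
Proof.
have -> : muln = fun k p => iteri k (fun i acc => acc + p) 0.
  by apply/funext => k; apply/funext => p; elim: k => //= k <-; rewrite mulSn addnC.
apply: (rec2_iteri (g := fun i acc p => acc + p) (rec1_const 0)).
exact: rec2_comp rec2_add (rec_proj _) (rec_proj _).
Qed.

Lemma rec1_odd : rec1 (fun k => nat_of_bool (odd k)).
Proof.
have -> : (fun k => nat_of_bool (odd k)) = fun k => iteri k (fun i acc => 1 - acc) 0.
  by apply/funext; elim=> //= k <-; case: odd.
exact: rec1_iteri (rec2_comp2 rec2_sub (rec2_const 1) rec2_snd).
Qed.

Lemma rec1_half : rec1 half.
Proof.
have -> : half = fun k => iteri k (fun i acc => odd i + acc) 0.
  by apply/funext; elim=> //= k <-; rewrite uphalf_half.
exact: rec1_iteri (rec2_comp2 rec2_add (rec2_comp1 rec1_odd rec2_fst) rec2_snd).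
Qed.

Lemma rec_if (b f g : nat -> nat) :
  rec1 b -> rec1 f -> rec1 g -> rec1 (fun x => if b x is 0 then g x else f x).
Proof.
move=> bR fR gR.
(* Subtraction is truncated: [1 - b x] is 1 if [b x] is 0, and 0 otherwise. *)
have -> : (fun x => if b x is 0 then g x else f x) =
    fun x => ((1 - b x) * g x + (1 - (1 - b x)) * f x).
  by apply/funext => x; case: (b x) => [|n]; rewrite ?mul1n ?mul0n ?addn0.
have R1 := rec1_comp2 rec2_sub (rec1_const 1).
exact: rec1_comp2 rec2_add (rec1_comp2 rec2_mul (R1 _ bR) gR)
  (rec1_comp2 rec2_mul (R1 _ (R1 _ bR)) fR).
Qed.

(* [code_head] and [code_tail] act on the codes of nonempty sequences:
   [CodeSeq.code (n :: s)] is [2 ^ n * (CodeSeq.code s).*2.+1]. *)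
Definition halve_even c := if odd c then c else c./2.
Definition code_head c := iteri c (fun i acc => ~~ odd (iter i halve_even c) + acc) 0.
Definition code_tail c := (iter c halve_even c)./2.

Lemma iter_halve_even k j o : iter k halve_even (2 ^ (k + j) * o) = (2 ^ j * o).
Proof.
elim: k => // k IH; rewrite iterSr -[RHS]IH; congr iter.
by rewrite addSn expnS -mulnA mul2n /halve_even odd_double doubleK.
Qed.

Lemma iter_halve_odd k o : odd o -> iter k halve_even o = o.
Proof. by move=> oddo; elim: k => //= k ->; rewrite /halve_even oddo. Qed.

Lemma lt_code_cons n s : (n < CodeSeq.code (n :: s)).
Proof. by have /andP[] := CodeSeq.ltn_code (n :: s). Qed.

(** The code is 2^n times an odd number, so exactly its first n iterates under [halve_even] are
    even, and [code_head] counts them. The code exceeds n, so that many rounds suffice. *)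
Lemma code_headE n s : code_head (CodeSeq.code (n :: s)) = n.
Proof.
rewrite /code_head; set c := CodeSeq.code (n :: s).
suff E k : iteri k (fun i acc => ~~ odd (iter i halve_even c) + acc) 0 = minn k n.
  by rewrite E; apply/minn_idPr/ltnW/lt_code_cons.
elim: k => [|k IH]; first by rewrite min0n.
rewrite iteriS {}IH /c /=; set o := (_.*2.+1).
have oddo : odd o by rewrite /= odd_double.
case: (ltnP k n) => [ltkn|lenk].
  rewrite -(subnKC ltkn) addSnnS iter_halve_even expnS -mulnA mul2n odd_double.
  have lekn := ltnW ltkn; rewrite add1n -addSnnS subnKC //.
  by rewrite (minn_idPl ltkn).
rewrite -{1}(subnK lenk) iterD -[X in 2 ^ X]addn0 iter_halve_even mul1n.
by rewrite iter_halve_odd // oddo add0n !(minn_idPr _) //; apply: leqW.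
Qed.

Lemma code_tailE n s : code_tail (CodeSeq.code (n :: s)) = CodeSeq.code s.
Proof.
rewrite /code_tail -{1}(subnK (ltnW (lt_code_cons n s))) iterD.
set k := (_ - _); rewrite /= -[X in 2 ^ X]addn0 iter_halve_even mul1n.
by rewrite iter_halve_odd /= ?odd_double // uphalf_double.
Qed.

Lemma rec2_iter_halve : rec2 (fun k c => iter k halve_even c).
Proof.
have -> : (fun k c => iter k halve_even c) = fun k c => iteri k (fun i acc => halve_even acc) c.
  by apply/funext => k; apply/funext => c; elim: k => //= k ->.
apply: rec2_iteri_acc rec1_id (rec2_comp1 _ rec2_snd).
have -> : halve_even = fun c => if nat_of_bool (odd c) is 0 then c./2 else c.
  by apply/funext => c; rewrite /halve_even; case: odd.
exact: rec_if rec1_odd rec1_id rec1_half.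
Qed.

Lemma rec1_code_tail : rec1 code_tail.
Proof. exact: rec1_comp1 rec1_half (rec1_comp2 rec2_iter_halve rec1_id rec1_id). Qed.

Lemma rec1_code_head : rec1 code_head.
Proof.
suff R : rec2 (fun k c =>
    iteri k (fun i acc => ~~ odd (iter i halve_even c) + acc) 0).
  exact: rec1_comp2 R rec1_id rec1_id.
apply: (rec2_iteri (g := fun i acc c => (~~ odd (iter i halve_even c) + acc))
          (rec1_const 0)).
apply: rec2_comp rec2_add _ (rec_proj _).
have R : rec1 (fun c => nat_of_bool (~~ odd c)).
  have -> : (fun c => nat_of_bool (~~ odd c)) = fun c => (1 - odd c).
    by apply/funext => c; case: odd.
  exact: rec1_comp2 rec2_sub (rec1_const 1) rec1_odd.
exact: rec1_comp R (rec2_comp rec2_iter_halve (rec_proj _) (rec_proj _)).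
Qed.

Definition code_cons n c := (2 ^ n * c.*2.+1).

Lemma rec2_code_cons : rec2 code_cons.
Proof.
have -> : code_cons = fun n c => (2 ^ n * (c + c).+1).
  by apply/funext => n; apply/funext => c; rewrite /code_cons addnn.
exact: rec2_comp2 rec2_mul (rec2_comp1 rec1_expn2 rec2_fst)
  (rec2_comp1 rec1_succ (rec2_comp2 rec2_add rec2_snd rec2_snd)).
Qed.

(** By conversion, [pickle] of a pair is this code of the numbers that [pickle] assigns to its
    components. *)
Definition code_pair a b := CodeSeq.code [:: a; b].

Lemma rec2_code_pair : rec2 code_pair.
Proof.
exact: rec2_comp2 rec2_code_cons rec2_fst
  (rec2_comp2 rec2_code_cons rec2_snd (rec2_const 0)).
Qed.
(** * Computable functions between countable types *)

Lemma computableP (T U : countType) (f : T -> U) :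
  computable f <-> exists2 g, rec1 g & forall x, g (pickle x) = pickle (f x).
Proof.
split=> -[g gR gE].
  exists (fun n => g [tuple n]) => //; apply: eq_recursive gR => v.
  by congr g; apply: eq_from_tnth => i; rewrite ord1 (tnth_nth 0).
by exists (fun v => g (tnth v ord0)) => // x; rewrite (tnth_nth 0) gE.
Qed.

Lemma computable_rec1 g : rec1 g -> computable g.
Proof. by move=> gR; apply/computableP; exists g. Qed.

Lemma computable_id (T : countType) : computable (fun x : T => x).
Proof. by apply/computableP; exists id => //; apply: rec1_id. Qed.

Lemma computable_const (T U : countType) (c : U) : computable (fun _ : T => c).
Proof. by apply/computableP; exists (fun=> pickle c) => //; apply: rec1_const. Qed.

Lemma computable_comp (T U V : countType) (g : U -> V) (f : T -> U) :
  computable g -> computable f -> computable (fun x => g (f x)).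
Proof.
move=> /computableP[g' gR gE] /computableP[f' fR fE]; apply/computableP.
by exists (fun n => g' (f' n)) => [|x]; [apply: rec1_comp1 | rewrite fE gE].
Qed.

Lemma computable_pickle (T : countType) : computable (@pickle T).
Proof. by apply/computableP; exists id => //; apply: rec1_id. Qed.

(** Encoding the sequence decoded from a number gives the number back, so on codes decoding acts as
    the identity. *)
Lemma computable_decode : computable CodeSeq.decode.
Proof.
apply/computableP; exists id => [|n]; first exact: rec1_id.
by rewrite -[RHS]/(CodeSeq.code (map id _)) map_id CodeSeq.decodeK.
Qed.

Lemma computable_rec2 (T : countType) (g : nat -> nat -> nat) (f1 f2 : T -> nat) :
  rec2 g -> computable f1 -> computable f2 -> computable (fun x => g (f1 x) (f2 x)).
Proof.
move=> gR /computableP[f1' f1R f1E] /computableP[f2' f2R f2E]; apply/computableP.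
exists (fun n => g (f1' n) (f2' n)) => [|x]; first exact: rec1_comp2.
by rewrite f1E f2E.
Qed.

Lemma computable_pair (T U V : countType) (f : T -> U) (g : T -> V) :
  computable f -> computable g -> computable (fun x => (f x, g x)).
Proof.
move=> /computableP[f' fR fE] /computableP[g' gR gE]; apply/computableP.
exists (fun n => code_pair (f' n) (g' n)) => [|x].
  exact: rec1_comp2 rec2_code_pair fR gR.
by rewrite fE gE.
Qed.

Lemma computable_fst (T U V : countType) (f : T -> U * V) :
  computable f -> computable (fun x => (f x).1).
Proof.
apply: computable_comp; apply/computableP.
by exists code_head => [|x]; [apply: rec1_code_head | apply: code_headE].
Qed.

Lemma computable_snd (T U V : countType) (f : T -> U * V) :
  computable f -> computable (fun x => (f x).2).
Proof.
apply: computable_comp; apply/computableP.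
exists (fun c => code_head (code_tail c)) => [|x].
  exact: rec1_comp1 rec1_code_head rec1_code_tail.
by rewrite code_tailE code_headE.
Qed.

Lemma computable_if (T U : countType) (b : T -> bool) (f g : T -> U) :
  computable b -> computable f -> computable g ->
  computable (fun x => if b x then f x else g x).
Proof.
move=> /computableP[b' bR bE] /computableP[f' fR fE] /computableP[g' gR gE].
apply/computableP; exists (fun n => if b' n is 0 then g' n else f' n) => [|x].
  exact: rec_if.
by rewrite bE fE gE; case: (b x).
Qed.

(** Only the empty sequence has code 0, so comparing the code with 0 selects the branch; [code_head]
    and [code_tail] supply the two parts. *)
Lemma computable_match_seq (T U V : countType) (s : T -> seq V) (f : T -> U)
    (g : V -> seq V -> T -> U) :
  computable s -> computable f ->
  computable (fun q : V * seq V * T => g q.1.1 q.1.2 q.2) ->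
  computable (fun x => if s x is y :: s' then g y s' x else f x).
Proof.
move=> /computableP[s' sR sE] /computableP[f' fR fE] /computableP[g' gR gE].
apply/computableP.
pose h n := code_pair (code_pair (code_head (s' n)) (code_tail (s' n))) n.
have hR : rec1 h.
  apply: rec1_comp2 rec2_code_pair _ rec1_id.
  exact: rec1_comp2 rec2_code_pair (rec1_comp1 rec1_code_head sR)
    (rec1_comp1 rec1_code_tail sR).
exists (fun n => if s' n is 0 then f' n else g' (h n)) => [|x].
  exact: rec_if sR (rec1_comp1 gR hR) fR.
rewrite /h sE fE; case: (s x) => // y t.
have -> : pickle (y :: t) = CodeSeq.code (pickle y :: map pickle t) by [].
rewrite code_headE code_tailE -(gE (y, t, x)).
by case: (CodeSeq.code _) (lt_code_cons (pickle y) (map pickle t)).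
Qed.

Lemma computable_cons (T U : countType) (f : T -> U) (s : T -> seq U) :
  computable f -> computable s -> computable (fun x => f x :: s x).
Proof.
move=> /computableP[f' fR fE] /computableP[s' sR sE]; apply/computableP.
exists (fun n => code_cons (f' n) (s' n)) => [|x].
  exact: rec1_comp2 rec2_code_cons fR sR.
by rewrite fE sE.
Qed.

Lemma computable_iteri (T U : countType) (n : T -> nat) (f : T -> U)
    (g : nat -> U -> T -> U) :
  computable n -> computable f ->
  computable (fun q : nat * U * T => g q.1.1 q.1.2 q.2) ->
  computable (fun x => iteri (n x) (fun i acc => g i acc x) (f x)).
Proof.
move=> /computableP[n' nR nE] /computableP[f' fR fE] /computableP[g' gR gE].
apply/computableP.
pose h i acc x := g' (code_pair (code_pair i acc) x).
exists (fun x => iteri (n' x) (fun i acc => h i acc x) (f' x)) => [|x].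
  suff R : rec2 (fun k x => iteri k (fun i acc => h i acc x) (f' x)).
    exact: rec1_comp2 R nR rec1_id.
  apply: rec2_iteri fR _; apply: rec1_comp gR _.
  apply: rec2_comp rec2_code_pair _ (rec_proj _).
  exact: rec2_comp rec2_code_pair (rec_proj _) (rec_proj _).
rewrite nE /=; elim: (n x) => [|k IH] //=.
by rewrite IH /h -(gE (k, _, x)).
Qed.

(** * Computability of arithmetic, boolean operations and equality *)

Section Nat.
Variable T : countType.
Implicit Types f g : T -> nat.

Lemma computable_succ f : computable f -> computable (fun x => (f x).+1).
Proof. exact: computable_comp (computable_rec1 rec1_succ). Qed.

Lemma computable_pred f : computable f -> computable (fun x => (f x).-1).
Proof. exact: computable_comp (computable_rec1 rec1_pred). Qed.

Lemma computable_expn2 f : computable f -> computable (fun x => 2 ^ f x).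
Proof. exact: computable_comp (computable_rec1 rec1_expn2). Qed.

Lemma computable_odd f : computable f -> computable (fun x => odd (f x)).
Proof.
move=> /computableP[f' fR fE]; apply/computableP.
exists (fun n => odd (f' n) : nat) => [|x]; last by rewrite fE.
exact: rec1_comp1 rec1_odd fR.
Qed.

Lemma computable_addn f g :
  computable f -> computable g -> computable (fun x => f x + g x).
Proof. exact: computable_rec2 rec2_add. Qed.

Lemma computable_subn f g :
  computable f -> computable g -> computable (fun x => f x - g x).
Proof. exact: computable_rec2 rec2_sub. Qed.

Lemma computable_eqn0 f : computable f -> computable (fun x => f x == 0).
Proof.
move=> /computableP[f' fR fE]; apply/computableP; exists (fun n => 1 - f' n) => [|x].
  exact: rec1_comp2 rec2_sub (rec1_const 1) fR.
by rewrite fE; case: (f x).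
Qed.

Lemma computable_leq f g :
  computable f -> computable g -> computable (fun x => f x <= g x).
Proof. by move=> fC gC; apply/computable_eqn0/computable_subn. Qed.

End Nat.

Section Bool.
Variable T : countType.
Implicit Types b c : T -> bool.

Lemma computable_negb b : computable b -> computable (fun x => ~~ b x).
Proof.
by move=> bC; apply: (computable_if bC); apply: computable_const.
Qed.

Lemma computable_andb b c :
  computable b -> computable c -> computable (fun x => b x && c x).
Proof. by move=> bC cC; apply: (computable_if bC cC); apply: computable_const. Qed.

Lemma computable_orb b c :
  computable b -> computable c -> computable (fun x => b x || c x).
Proof. by move=> bC cC; apply: (computable_if bC _ cC); apply: computable_const. Qed.

Lemma computable_eq_op (U : countType) (f g : T -> U) :
  computable f -> computable g -> computable (fun x => f x == g x).
Proof.
move=> fC gC.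
have -> : (fun x => f x == g x) = fun x => (pickle (f x) <= pickle (g x))
    && (pickle (g x) <= pickle (f x)).
  by apply/funext => x; rewrite -eqn_leq (inj_eq (pcan_inj pickleK)).
by apply: computable_andb; apply: computable_leq; apply: computable_comp (computable_pickle _) _.
Qed.

End Bool.

(** * Computability of loops over sequences *)

Lemma leq_size_pickle (T : countType) (s : seq T) : size s <= pickle s.
Proof.
elim: s => //= y t IH; apply: leq_ltn_trans IH _.
rewrite -[X in _ < X]/(2 ^ pickle y * (pickle t).*2.+1).
by rewrite -[(pickle t).+1]mul1n leq_mul ?expn_gt0 // ltnS -addnn leq_addr.
Qed.

Lemma computable_iter (T U : countType) (n : T -> nat) (f : T -> U)
    (g : U -> T -> U) :
  computable n -> computable f -> computable (fun q : U * T => g q.1 q.2) ->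
  computable (fun x => iter (n x) (g^~ x) (f x)).
Proof.
move=> nC fC gC.
have -> : (fun x => iter (n x) (g^~ x) (f x)) =
    (fun x => iteri (n x) (fun i acc => g acc x) (f x)).
  by apply/funext => x; elim: (n x) => //= k ->.
apply: (computable_iteri (g := fun _ acc x => g acc x)) => //.
have := computable_comp gC (computable_pair (T := (nat * U * T)%type)
  (computable_snd (computable_fst (computable_id _))) (computable_snd (computable_id _))).
exact.
Qed.

(* A sequence of code [c] has at most [c] items, so that [c] steps suffice. *)
Lemma computable_foldl (T U V : countType) (s : T -> seq V) (f : T -> U)
    (g : U -> V -> T -> U) :
  computable s -> computable f ->
  computable (fun q : U * V * T => g q.1.1 q.1.2 q.2) ->
  computable (fun x => foldl (fun acc y => g acc y x) (f x) (s x)).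
Proof.
move=> sC fC gC.
pose step (acc : U * seq V) x := if acc.2 is y :: t then (g acc.1 y x, t) else acc.
have -> : (fun x => foldl (fun acc y => g acc y x) (f x) (s x)) =
    (fun x => (iter (pickle (s x)) (step^~ x) (f x, s x)).1).
  apply/funext => x; have := leq_size_pickle (s x).
  elim: (s x) (f x) (pickle (s x)) => [|y t IH] z n.
    (* Once the sequence is used up the state is stationary, so surplus steps do no harm. *)
    by move=> _; have -> : iter n (step^~ x) (z, [::]) = (z, [::]) by elim: n => //= n ->.
  by case: n => // n lt; rewrite iterSr /= -IH.
apply/computable_fst/computable_iter.
- exact: computable_comp (computable_pickle _) sC.
- exact: computable_pair.
have C1 := computable_fst (computable_id ((U * seq V) * T)%type).
apply: (computable_match_seq (g := fun y t q => (g q.1.1 y q.2, t))) => //.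
  exact: computable_snd C1.
pose Q := (V * seq V * (U * seq V * T))%type.
have D1 := computable_fst (computable_id Q); have D2 := computable_snd (computable_id Q).
apply: computable_pair; last exact: computable_snd D1.
by have := computable_comp gC (computable_pair (computable_pair
  (computable_fst (computable_fst D2)) (computable_fst D1)) (computable_snd D2)).
Qed.
Lemma computable_rev (T U : countType) (s : T -> seq U) :
  computable s -> computable (fun x => rev (s x)).
Proof.
move=> sC.
have -> : (fun x => rev (s x)) = (fun x => foldl (fun acc y => y :: acc) [::] (s x)).
  apply/funext => x; rewrite /rev; move: (s x) [::].
  by elim=> //= y t IH acc; rewrite IH.
apply: (computable_foldl (g := fun acc y _ => y :: acc)) => //.
  exact: computable_const.
have C := computable_fst (computable_id (seq U * U * T)%type).
exact: computable_cons (computable_snd C) (computable_fst C).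
Qed.

Lemma computable_foldr (T U V : countType) (s : T -> seq V) (f : T -> U)
    (g : V -> U -> T -> U) :
  computable s -> computable f ->
  computable (fun q : V * U * T => g q.1.1 q.1.2 q.2) ->
  computable (fun x => foldr (fun y acc => g y acc x) (f x) (s x)).
Proof.
move=> sC fC gC.
have -> : (fun x => foldr (fun y acc => g y acc x) (f x) (s x)) =
    (fun x => foldl (fun acc y => g y acc x) (f x) (rev (s x))).
  by apply/funext => x; rewrite foldl_rev.
apply: (computable_foldl (g := fun acc y x => g y acc x)) => //.
  exact: computable_rev.
have C := computable_id (U * V * T)%type.
have := computable_comp gC (computable_pair (computable_pair
  (computable_snd (computable_fst C)) (computable_fst (computable_fst C)))
  (computable_snd C)); exact.
Qed.

Lemma computable_map (T U V : countType) (s : T -> seq V) (g : V -> T -> U) :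
  computable s -> computable (fun q : V * T => g q.1 q.2) ->
  computable (fun x => map (g^~ x) (s x)).
Proof.
move=> sC gC.
apply: (computable_foldr (g := fun y acc x => g y x :: acc)) => //.
  exact: computable_const.
have C := computable_id (V * seq U * T)%type.
apply: computable_cons; last exact: computable_snd (computable_fst C).
have := computable_comp gC (computable_pair (computable_fst (computable_fst C))
  (computable_snd C)); exact.
Qed.

Lemma computable_all (T V : countType) (s : T -> seq V) (p : V -> T -> bool) :
  computable s -> computable (fun q : V * T => p q.1 q.2) ->
  computable (fun x => all (p^~ x) (s x)).
Proof.
move=> sC pC.
have -> : (fun x => all (p^~ x) (s x)) =
    fun x => foldr (fun y acc => p y x && acc) true (s x) by [].
apply: (computable_foldr (g := fun y acc x => p y x && acc)) => //.
  exact: computable_const.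
have C := computable_id (V * bool * T)%type.
apply: computable_andb; last exact: computable_snd (computable_fst C).
have := computable_comp pC (computable_pair (computable_fst (computable_fst C))
  (computable_snd C)); exact.
Qed.

Lemma computable_cat (T V : countType) (s t : T -> seq V) :
  computable s -> computable t -> computable (fun x => s x ++ t x).
Proof.
move=> sC tC.
have -> : (fun x => s x ++ t x) = (fun x => foldr cons (t x) (s x)).
  by apply/funext => x; elim: (s x) => //= y s' ->.
apply: (computable_foldr (g := fun y acc _ => y :: acc)) => //.
have C := computable_fst (computable_id (V * seq V * T)%type).
exact: computable_cons (computable_fst C) (computable_snd C).
Qed.

Lemma computable_size (T V : countType) (s : T -> seq V) :
  computable s -> computable (fun x => size (s x)).
Proof.
move=> sC.
have -> : (fun x => size (s x)) = (fun x => foldr (fun _ => S) 0 (s x)) by [].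
apply: (computable_foldr (g := fun _ acc _ => acc.+1)) => //.
  exact: computable_const.
exact: computable_succ (computable_snd (computable_fst (computable_id _))).
Qed.

Lemma computable_iota (T : countType) (n : T -> nat) :
  computable n -> computable (fun x => iota 0 (n x)).
Proof.
move=> nC.
have -> : (fun x => iota 0 (n x)) =
    (fun x => iteri (n x) (fun i acc => acc ++ [:: i]) [::]).
  by apply/funext => x; elim: (n x) => // k IH; rewrite -addn1 iotaD IH addn1.
apply: (computable_iteri (g := fun i acc _ => acc ++ [:: i])) => //.
  exact: computable_const.
have C := computable_fst (computable_id (nat * seq nat * T)%type).
apply: computable_cat; first exact: computable_snd C.
exact: computable_cons (computable_fst C) (computable_const _ _).
Qed.

Lemma computable_nth (T V : countType) (a : V) (s : T -> seq V) (n : T -> nat) :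
  computable s -> computable n -> computable (fun x => nth a (s x) (n x)).
Proof.
move=> sC nC.
have -> : (fun x => nth a (s x) (n x)) = (fun x =>
   if iter (n x) (fun t => if t is _ :: t' then t' else [::]) (s x) is y :: _ then y else a).
  apply/funext => x; elim: (n x) (s x) => [|k IH] [|y t] //; rewrite iterSr -IH //.
  by rewrite !nth_nil.
apply: (computable_match_seq (g := fun y _ _ => y)) => //; first last.
- exact: computable_fst (computable_fst (computable_id _)).
- exact: computable_const.
apply: (computable_iter (g := fun t _ => if t is _ :: t' then t' else [::])) => //.
apply: (computable_match_seq (g := fun _ t _ => t)).
- exact: computable_fst (computable_id _).
- exact: computable_const.
exact: computable_snd (computable_fst (computable_id _)).
Qed.

(** Applies the closure lemmas according to the head symbol of the function body. Conditionals,
    folds and calls of other defined functions remain as goals, to be treated by hand. *)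
Ltac computability := repeat (assumption || lazymatch goal with
  | |- computable (fun x => x) => exact: computable_id
  | |- computable fst => exact: (computable_fst (computable_id _))
  | |- computable snd => exact: (computable_snd (computable_id _))
  | |- computable size => exact: (computable_size (computable_id _))
  | |- computable CodeSeq.decode => exact: computable_decode
  | |- computable S => exact: (computable_succ (computable_id _))
  | |- computable (fun _ => ?c) => exact: computable_const
  | |- computable (fun x => pair (@?f x) (@?g x)) => apply: computable_pair
  | |- computable (fun x => fst (@?f x)) => apply: computable_fst
  | |- computable (fun x => snd (@?f x)) => apply: computable_snd
  | |- computable (fun x => leq (@?f x) (@?g x)) => apply: computable_leq
  | |- computable (fun x => S (@?f x)) => apply: computable_succ
  | |- computable (fun x => predn (@?f x)) => apply: computable_pred
  | |- computable (fun x => addn (@?f x) (@?g x)) => apply: computable_addn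
  | |- computable (fun x => subn (@?f x) (@?g x)) => apply: computable_subn
  | |- computable (fun x => expn 2 (@?f x)) => apply: computable_expn2
  | |- computable (fun x => odd (@?f x)) => apply: computable_odd
  | |- computable (fun x => andb (@?f x) (@?g x)) => apply: computable_andb
  | |- computable (fun x => orb (@?f x) (@?g x)) => apply: computable_orb
  | |- computable (fun x => negb (@?f x)) => apply: computable_negb
  | |- computable (fun x => eq_op (@?f x) (@?g x)) => apply: computable_eq_op
  | |- computable (fun x => size (@?f x)) => apply: computable_size
  | |- computable (fun x => iota 0 (@?f x)) => apply: computable_iota
  | |- computable (fun x => cons (@?f x) (@?g x)) => apply: computable_cons
  | |- computable (fun x => cat (@?f x) (@?g x)) => apply: computable_cat
  | |- computable (fun x => rev (@?f x)) => apply: computable_rev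
  | |- computable (fun x => nth _ (@?f x) (@?g x)) => apply: computable_nth
  | |- computable (fun x => CodeSeq.decode (@?f x)) => apply: (computable_comp computable_decode)
  end).

Local Open Scope group_scope.

(** * The wreath product with the integers *)

(* The pair [(phi, m)] of a function with support bounded below and a shift;
   [m] acts on functions by [(m . psi) n = psi (n + m)]. *)
Record wreath (A : groupType) := Wreath {
  wfun :> int -> A;
  wshift : int;
  _ : exists N : int, forall n : int, (n < N)%R -> wfun n = 1 }.

HB.instance Definition _ (A : groupType) := gen_eqMixin (wreath A).
HB.instance Definition _ (A : groupType) := gen_choiceMixin (wreath A).

Section Wreath.
Variable A : groupType.
Implicit Types u v w : wreath A.

Lemma wreath_eq u v : u =1 v -> wshift u = wshift v -> u = v.
Proof.
case: u v => [phi m bphi] [psi k bpsi] /= /funext E F.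
by move: E F bphi bpsi => -> -> bphi bpsi; congr Wreath.
Qed.

Lemma wfun_bounded u : exists N : int, forall n : int, (n < N)%R -> u n = 1.
Proof. by case: u. Qed.

Fact wreath_one_bounded :
  exists N : int, forall n : int, (n < N)%R -> (fun=> 1) n = 1 :> A.
Proof. by exists 0%R. Qed.

Fact wreath_mul_bounded u v : exists N : int, forall n : int, (n < N)%R ->
  u n * v (n + wshift u)%R = 1.
Proof.
have [[N uN] [M vM]] := (wfun_bounded u, wfun_bounded v).
exists (- (`|N| + `|M| + `|wshift u|)%:Z)%R => n ltn.
by rewrite uN ?vM ?mulg1 //; lia.
Qed.

Fact wreath_inv_bounded u : exists N : int, forall n : int, (n < N)%R ->
  (u (n - wshift u)%R)^-1 = 1.
Proof.
have [N uN] := wfun_bounded u; exists (N + wshift u)%R => n ltn.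
by rewrite uN ?invg1 //; lia.
Qed.

Definition wreath_one := Wreath 0%R wreath_one_bounded.
Definition wreath_mul u v := Wreath (wshift u + wshift v)%R (wreath_mul_bounded u v).
Definition wreath_inv u := Wreath (- wshift u)%R (wreath_inv_bounded u).

Fact wreath_mulA : associative wreath_mul.
Proof.
by move=> u v w; apply: wreath_eq => [n|] /=; rewrite ?mulgA ?GRing.addrA.
Qed.

Fact wreath_mul1 : left_id wreath_one wreath_mul.
Proof.
by move=> u; apply: wreath_eq => [n|] /=; rewrite ?mul1g ?GRing.addr0 ?GRing.add0r.
Qed.

Fact wreath_1mul : right_id wreath_one wreath_mul.
Proof. by move=> u; apply: wreath_eq => [n|] /=; rewrite ?mulg1 ?GRing.addr0. Qed.

Fact wreath_mulV : left_inverse wreath_one wreath_inv wreath_mul.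
Proof. by move=> u; apply: wreath_eq => [n|] /=; rewrite ?mulVg ?GRing.addNr. Qed.

Fact wreath_Vmul : right_inverse wreath_one wreath_inv wreath_mul.
Proof.
by move=> u; apply: wreath_eq => [n|] /=; rewrite ?GRing.addrK ?mulgV ?GRing.addrN.
Qed.

HB.instance Definition _ := isGroup.Build (wreath A)
  wreath_mulA wreath_mul1 wreath_1mul wreath_mulV wreath_Vmul.

Lemma wfunM u v n : (u * v) n = u n * v (n + wshift u)%R.
Proof. by []. Qed.

Lemma wfunV u n : u^-1 n = (u (n - wshift u)%R)^-1.
Proof. by []. Qed.

Lemma wfun1 n : (1 : wreath A) n = 1.
Proof. by []. Qed.

Lemma wshiftM u v : wshift (u * v) = (wshift u + wshift v)%R.
Proof. by []. Qed.

Lemma wshiftV u : wshift u^-1 = (- wshift u)%R.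
Proof. by []. Qed.

Lemma wshift1 : wshift (1 : wreath A) = 0%R.
Proof. by []. Qed.

Definition wreathE := (wfunM, wfunV, wfun1, wshiftM, wshiftV, wshift1).

Lemma wshift_conj u v : wshift (u ^ v) = wshift u.
Proof. by rewrite /conjg !wreathE; lia. Qed.

Lemma wfun_conj u v n : wshift u = 0%R ->
  (u ^ v) n = u (n - wshift v)%R ^ v (n - wshift v)%R.
Proof. by rewrite /conjg !wreathE => ->; rewrite GRing.addr0. Qed.

Lemma wshift_comm u v : wshift [~ u, v] = 0%R.
Proof. by rewrite /commg wshiftM wshift_conj wshiftV GRing.addNr. Qed.

Lemma wfun_comm u v n : wshift u = 0%R -> wshift v = 0%R -> [~ u, v] n = [~ u n, v n].
Proof. by rewrite /commg /conjg !wreathE => -> ->; rewrite ?GRing.oppr0 !GRing.addr0. Qed.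

Definition wreath_shift (m : int) := Wreath m wreath_one_bounded.

Fact wdelta_bounded (a : A) : exists N : int, forall n : int, (n < N)%R ->
  (if n == 0%R then a else 1) = 1.
Proof. by exists 0%R => n ltn; case: eqP ltn => // ->. Qed.

Definition wdelta a := Wreath 0%R (wdelta_bounded a).

Lemma wdeltaM : {morph wdelta : a b / a * b}.
Proof.
move=> a b; apply: wreath_eq => [n|] //=; rewrite GRing.addr0.
by case: eqP => _; rewrite ?mulg1.
Qed.

HB.instance Definition _ := isMultiplicative.Build A (wreath A) wdelta wdeltaM.

Lemma wdelta_inj : injective wdelta.
Proof. by move=> a b /(congr1 (fun w : wreath A => w 0%R)). Qed.

Lemma wdelta_range u :
  (range wdelta) u <-> wshift u = 0%R /\ forall n, n <> 0%R -> u n = 1.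
Proof.
split=> [[a _ <-]|[u0 uE]]; first by split=> //= n /eqP/negbTE ->.
exists (u 0%R) => //; apply: wreath_eq => //= n.
by case: eqP => [-> //|/uE ->].
Qed.

(** This is what supports bounded below are for: the least number principle, applied to offsets from
    the bound, finds the leftmost nontrivial coordinate. *)
Lemma wfun_first u : ~ (forall n, u n = 1) ->
  exists2 n, u n <> 1 & forall k : int, (k < n)%R -> u k = 1.
Proof.
move=> /existsNP[n un]; have [N uN] := wfun_bounded u.
pose p k := u (N + k%:Z)%R != 1.
have exp : exists k, p k.
  exists `|n - N|%N; rewrite /p; apply/eqP.
  case: (ltP n N) => [/uN //|leNn]; have -> // : (N + `|n - N|%N%:Z)%R = n by lia.
exists (N + (ex_minn exp)%:Z)%R; case: ex_minnP => m pm minm; first exact/eqP.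
move=> k ltk; case: (ltP k N) => [/uN //|leNk].
apply/eqP/negPn/negP => uk; have := minm `|k - N|%N.
by have E : (N + `|k - N|%N%:Z)%R = k; [lia | rewrite /p E uk => /(_ isT); lia].
Qed.

End Wreath.

(** * Positive cones *)

(** The elements that are at least 1 in an order, 1 included. Left-orders and such cones correspond
    through [cone_of] and [order_of], so orders are built and transported as cones. *)
Definition left_cone (A : groupType) (P : set A) : Prop :=
  [/\ P 1, forall a b, P a -> P b -> P (a * b), forall a, P a -> P a^-1 -> a = 1
    & forall a, P a \/ P a^-1].

Definition bi_cone (A : groupType) (P : set A) : Prop :=
  left_cone P /\ forall a b, P a -> P (a ^ b).

Definition cone_of (A : groupType) (le : rel A) : set A := [set a | le 1 a].
Definition order_of (A : groupType) (P : set A) : rel A := fun a b => `[< P (a^-1 * b) >].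

Lemma left_cone_of (A : groupType) (le : rel A) : left_order le -> left_cone (cone_of le).
Proof.
move=> [anti tr tot inv]; split.
- by rewrite /cone_of /=; have := tot 1 1; rewrite orbb.
- move=> a b a1 b1; apply: tr (a1) _; rewrite -{1}[a]mulg1; exact: inv.
- move=> a a1 /(inv a); rewrite mulg1 mulgV => a2; apply: anti.
  by rewrite a2.
- move=> a; case/orP: (tot 1 a) => [|/(inv a^-1)]; first by left.
  by rewrite mulg1 mulVg; right.
Qed.

Lemma bi_cone_of (A : groupType) (le : rel A) : bi_order le -> bi_cone (cone_of le).
Proof.
move=> [lo inv]; split; first exact: left_cone_of.
have [_ _ _ linv] := lo; move=> a b; rewrite /cone_of /= => /(linv b^-1) /(inv b).
by rewrite mulg1 mulVg -mulgA.
Qed.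

Lemma order_of_left (A : groupType) (P : set A) : left_cone P -> left_order (order_of P).
Proof.
move=> [P1 PM anti tot]; split.
- move=> a b /andP[/asboolP Pab /asboolP Pba].
  have /anti/(_ _)/(congr1 (mul a)) : P (a^-1 * b) by [].
  by rewrite invgM invgK mulg1 mulVKg => ->.
- move=> b a c /asboolP Pab /asboolP Pbc; apply/asboolP.
  by have := PM _ _ Pab Pbc; rewrite mulgA mulgK.
- move=> a b; apply/orP; case: (tot (a^-1 * b)) => p; [left|right]; apply/asboolP => //.
  by move: p; rewrite invgM invgK.
- move=> g a b /asboolP p; apply/asboolP.
  by rewrite invgM -mulgA mulKg.
Qed.

Lemma order_of_bi (A : groupType) (P : set A) : bi_cone P -> bi_order (order_of P).
Proof.
move=> [lP PJ]; split; first exact: order_of_left.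
move=> g a b /asboolP/(PJ _ g) p; apply/asboolP; move: p.
by rewrite /conjg invgM !mulgA.
Qed.

(** * The lexicographic cone of a wreath product *)

Section WreathCone.
Variables (A : groupType) (P : set A).

(* Left of the leftmost nontrivial value, the condition only asks for [P 1]. *)
Definition wreath_cone : set (wreath A) := [set w |
  (0 < wshift w)%R \/
  wshift w = 0%R /\ forall n : int, (forall k : int, (k < n)%R -> w k = 1) -> P (w n)].

Lemma wreath_cone_left : left_cone P -> left_cone wreath_cone.
Proof.
move=> [P1 PM anti tot].
have first_P (w : wreath A) : wshift w = 0%R -> (forall n, w n = 1) \/
    exists2 n, w n <> 1 & forall k : int, (k < n)%R -> w k = 1.
  move=> w0; case: (pselect (forall n, w n = 1)); [by left | by move/wfun_first; right].
have cone_nat (w : wreath A) (n : int) : wshift w = 0%R ->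
    (forall k : int, (k < n)%R -> w k = 1) -> w n <> 1 -> P (w n) -> wreath_cone w.
  move=> w0 lt1 wn1 Pwn; right; split=> // m mP.
  case: (ltgtP m n) => [/lt1 -> //|ltnm|-> //].
  by case: wn1; apply: mP.
split.
- by right; split.
- move=> u v [u_gt|[u0 uP]] [v_gt|[v0 vP]].
  + by left; rewrite wshiftM; lia.
  + by left; rewrite wshiftM; lia.
  + by left; rewrite wshiftM; lia.
  right; rewrite wshiftM u0 v0; split=> // n uv1.
  have uv k : (u * v) k = u k * v k by rewrite wfunM u0 GRing.addr0.
  (* If [u] had its first nontrivial coordinate [m] left of [n], then [v] would be inverse to [u] up
     to [m], and both [u m] and its inverse would lie in [P]. *)
  have u1 k : (k < n)%R -> u k = 1.
    move=> ltkn; case: (first_P u u0) => [//|[m um1 ult]].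
    have ltmk : ~ (m <= k)%R.
      move=> lemk; have ltmn : (m < n)%R by lia.
      have vE j : (j <= m)%R -> v j = (u j)^-1.
        by move=> lejm; apply/esym/mulg1_eq; rewrite -uv uv1 //; lia.
      have := vP m; rewrite vE // => Pv.
      apply: um1; apply: anti (uP _ ult) (Pv _) => j ltjm.
      by rewrite vE ?ult ?invg1 // ltW.
    by apply: ult; lia.
  have v1 k : (k < n)%R -> v k = 1.
    by move=> ltkn; have := uv1 k ltkn; rewrite uv u1 // mul1g.
  by rewrite uv; apply: PM; [apply: uP | apply: vP].
- move=> u [u_gt|[u0 uP]] [|[uV0 uVP]]; rewrite ?wshiftV; try by lia.
    by move: uV0; rewrite wshiftV; lia.
  apply: wreath_eq => // n; case: (first_P u u0) => [-> //|[m um1 ult]].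
  case: um1; apply: anti (uP _ ult) _.
  have := uVP m; rewrite wfunV u0 GRing.subr0; apply=> k ltkm.
  by rewrite wfunV u0 GRing.subr0 ult ?invg1.
- move=> u; case: (ltgtP 0%R (wshift u)) => [u_gt|u_lt|/esym u0].
  + by left; left.
  + by right; left; rewrite wshiftV; lia.
  have uV k : u^-1 k = (u k)^-1 by rewrite wfunV u0 GRing.subr0.
  case: (first_P u u0) => [u1|[n un1 ult]].
    by left; right; split=> // n _; rewrite u1.
  case: (tot (u n)) => Pu; first by left; exact: (cone_nat u n).
  right; apply: (cone_nat u^-1 n); rewrite ?uV ?wshiftV ?u0 //.
    by move=> k ltkn; rewrite uV ult ?invg1.
  by move/(congr1 inv); rewrite invgK invg1.
Qed.

(** Conjugation keeps the shift; on a base element it translates the leftmost nontrivial coordinate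
    and conjugates its value, under which [P] is stable. *)
Lemma wreath_cone_bi : bi_cone P -> bi_cone wreath_cone.
Proof.
move=> [lP PJ]; split; first exact: wreath_cone_left.
move=> u v [u_gt|[u0 uP]]; [by left; rewrite wshift_conj | right].
rewrite wshift_conj; split=> // n uv1; rewrite wfun_conj //; apply/PJ/uP => k ltk.
have := uv1 (k + wshift v)%R; rewrite wfun_conj // GRing.addrK => uv.
by apply/eqP; rewrite -(conjg_eq1 _ (v k)); apply/eqP/uv; lia.
Qed.

Lemma wreath_cone_delta a : P 1 -> wreath_cone (wdelta a) <-> P a.
Proof.
move=> P1; split=> [[//|[_ /(_ 0%R)]]|Pa].
  by apply=> k ltk /=; case: eqP ltk => // ->.
by right; split=> // n _ /=; case: eqP.
Qed.

End WreathCone.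
(** * Subgroups and derived series *)

Section Multiplicative.
Variables (G K : groupType) (f : {multiplicative G -> K}).

Lemma multiplicative1 : f 1 = 1.
Proof. by apply: (mulgI (f 1)); rewrite -gmulfM !mulg1. Qed.

Lemma multiplicativeV a : f a^-1 = (f a)^-1.
Proof. by apply: (mulgI (f a)); rewrite -gmulfM !mulgV multiplicative1. Qed.

Lemma multiplicativeJ a b : f (a ^ b) = f a ^ f b.
Proof. by rewrite /conjg !gmulfM multiplicativeV. Qed.

Lemma multiplicativeR a b : f [~ a, b] = [~ f a, f b].
Proof. by rewrite /commg gmulfM multiplicativeJ multiplicativeV. Qed.

End Multiplicative.

Lemma subgroupP (G : groupType) (A : set G) :
  subgroup A <-> A 1 /\ forall a b, A a -> A b -> A (a / b).
Proof.
split=> -[A1 AF]; split.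
- exact: set_mem A1.
- by move=> a b /mem_set Aa /mem_set Ab; apply/set_mem/AF.
- exact: mem_set.
- by move=> a b /set_mem Aa /set_mem Ab; apply/mem_set/AF.
Qed.

Section Subgroup.
Variables (G : groupType) (A : set G).
Hypothesis A_subgroup : subgroup A.

Lemma subgroup1 : A 1. Proof. by case/subgroupP: A_subgroup. Qed.

Lemma subgroupF a b : A a -> A b -> A (a / b).
Proof. by case/subgroupP: A_subgroup => _; apply. Qed.

Lemma subgroupV a : A a -> A a^-1.
Proof. by move/(subgroupF subgroup1); rewrite div1g. Qed.

Lemma subgroupM a b : A a -> A b -> A (a * b).
Proof. by move=> Aa /subgroupV; rewrite -{2}[b]invgK; apply: subgroupF. Qed.

Lemma eval_word_subgroup (I : Type) (x : I -> G) w : (forall i, A (x i)) -> A (eval_word x w).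
Proof.
move=> Ax; rewrite /eval_word; elim/big_ind: _ => [|a b|[i []] _ /=].
- exact: subgroup1.
- exact: subgroupM.
- exact: subgroupV.
- exact: Ax.
Qed.

End Subgroup.

Lemma generated_subgroup (G : groupType) (A : set G) : subgroup (generated A).
Proof.
apply/subgroupP; split=> [B [Bsub _]|a b Aa Ab B BA]; first exact: subgroup1.
by apply: (subgroupF BA.1); [apply: Aa | apply: Ab].
Qed.

Lemma sub_generated (G : groupType) (A : set G) : A `<=` generated A.
Proof. exact: sub_gen_smallest. Qed.

Lemma generated_sub (G : groupType) (A B : set G) :
  subgroup B -> A `<=` B -> generated A `<=` B.
Proof. by move=> Bsub AB a; apply. Qed.

(** Started at an arbitrary subset, so that the derived series of a generated subgroup can be
    followed inside the ambient group. *)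
Definition derived_series (G : groupType) (A : set G) n : set G :=
  iter n (@commutator_subgroup G) A.

Lemma derived_series_comm (G : groupType) (A : set G) n a b :
  derived_series A n a -> derived_series A n b -> derived_series A n.+1 [~ a, b].
Proof. by move=> Aa Ab; apply: sub_generated; exists a => //; exists b. Qed.

Lemma derived_series_sub (G : groupType) (A B : set G) n : subgroup B ->
  (forall a b, derived_series A n a -> derived_series A n b -> B [~ a, b]) ->
  derived_series A n.+1 `<=` B.
Proof. by move=> Bsub AB; apply: generated_sub => // _ [a Aa [b Ab <-]]; apply: AB. Qed.

Lemma derived_seriesS_subgroup (G : groupType) (A : set G) n :
  subgroup (derived_series A n.+1).
Proof. exact: generated_subgroup. Qed.

Lemma derived_series_iter (G : groupType) (A : set G) m n :
  derived_series (derived_series A n) m = derived_series A (m + n).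
Proof. by rewrite /derived_series iterD. Qed.

Lemma derived_series_mono (G : groupType) (A B : set G) n :
  A `<=` B -> derived_series A n `<=` derived_series B n.
Proof.
move=> AB; elim: n => // n IH; apply: derived_series_sub.
  exact: derived_seriesS_subgroup.
by move=> a b /IH Ba /IH Bb; apply: derived_series_comm.
Qed.

Lemma setT_subgroup (G : groupType) : subgroup [set: G].
Proof. exact/subgroupP. Qed.

Lemma derived_subgroup (G : groupType) n : subgroup (derived G n).
Proof. by case: n => [|n]; [apply: setT_subgroup | apply: generated_subgroup]. Qed.

Lemma image_subgroup (G K : groupType) (f : {multiplicative G -> K}) (A : set G) :
  subgroup A -> subgroup (f @` A).
Proof.
move=> Asub; apply/subgroupP; split.
  by exists 1; [apply: (subgroup1 Asub) | apply: multiplicative1].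
move=> _ _ [a Aa <-] [b Ab <-]; exists (a / b); first exact: (subgroupF Asub).
by rewrite gmulfM multiplicativeV.
Qed.

Lemma derived_series_image (G K : groupType) (f : {multiplicative G -> K}) (A : set G) n :
  f @` derived_series A n = derived_series (f @` A) n.
Proof.
elim: n => // n IH; apply/seteqP; split.
  have Bsub : subgroup (f @^-1` derived_series (f @` A) n.+1).
    have S := derived_seriesS_subgroup (f @` A) n.
    apply/subgroupP; split; first by rewrite /= multiplicative1; apply: (subgroup1 S).
    by move=> a b Aa Ab; rewrite /= gmulfM multiplicativeV; apply: (subgroupF S).
  move=> _ [a Aa <-]; apply: (derived_series_sub Bsub) Aa => b c Ab Ac.
  by rewrite /= multiplicativeR; apply: derived_series_comm; rewrite -IH; [exists b | exists c].
apply: derived_series_sub.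
  exact/image_subgroup/derived_seriesS_subgroup.
rewrite -IH => _ _ [a Aa <-] [b Ab <-]; exists [~ a, b]; last exact: multiplicativeR.
exact: derived_series_comm.
Qed.

(** * Derived series of wreath products *)

Section WreathDerived.
Variable A : groupType.

(** On elements of shift 0, evaluation at 0 is a morphism; this projection serves to bound derived
    lengths from below. *)
Definition wproj (V : set (wreath A)) : set A :=
  [set a | exists2 v, V v & wshift v = 0%R /\ v 0%R = a].

Lemma wproj_subgroup (V : set (wreath A)) : subgroup V -> subgroup (wproj V).
Proof.
move=> S; apply/subgroupP; split; first by exists 1 => //; apply: (subgroup1 S).
move=> _ _ [u Vu [u0 <-]] [v Vv [v0 <-]]; exists (u / v); first exact: (subgroupF S).
by rewrite !wreathE u0 v0 !GRing.addr0.
Qed.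

(** The commutator of two elements of shift 0 has shift 0, and its value at 0 is the commutator of
    their values. A lower bound on these values thus propagates along the series. *)
Lemma wproj_derived_series (T : set A) (V : set (wreath A)) n :
  T `<=` wproj V -> derived_series T n `<=` wproj (derived_series V n).
Proof.
elim: n => [//|n IH] /IH {}IH; apply: derived_series_sub.
  exact/wproj_subgroup/derived_seriesS_subgroup.
move=> _ _ /IH[u Vu [u0 <-]] /IH[v Vv [v0 <-]].
exists [~ u, v]; first exact: derived_series_comm.
by rewrite wshift_comm wfun_comm.
Qed.

(** The first commutators lose the shift; all later ones are taken coordinate by coordinate in [A].
    So one wreath product adds at most one to the derived length. *)
Lemma derived_wreath n : derived (wreath A) n.+1 `<=`
  [set w | wshift w = 0%R /\ forall k, derived A n (w k)].
Proof.
have sub m : subgroup [set w : wreath A | wshift w = 0%R /\ forall k, derived A m (w k)].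
  have S := derived_subgroup A m.
  apply/subgroupP; split; first by split=> // k; apply: (subgroup1 S).
  move=> u v [u0 uS] [v0 vS]; split=> [|k]; first by rewrite wshiftM wshiftV u0 v0.
  by rewrite wfunM wfunV; apply: (subgroupF S).
rewrite -[derived _ _]/(derived_series setT n.+1).
elim: n => [|n IH]; apply: derived_series_sub (sub _) _.
  by move=> u v _ _; split=> //; apply: wshift_comm.
move=> u v /IH[u0 uS] /IH[v0 vS]; split; first exact: wshift_comm.
move=> k; rewrite (wfun_comm _ u0 v0).
exact: (@derived_series_comm _ setT n _ _ (uS k) (vS k)).
Qed.

End WreathDerived.
(** * Decision problems in wreath products *)

Section EvalWord.
Variables (G : groupType) (I : Type) (x : I -> G).

Lemma eval_word_nil : eval_word x [::] = 1.
Proof. exact: big_nil. Qed.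

Lemma eval_word_cons l u :
  eval_word x (l :: u) = (if l.2 then (x l.1)^-1 else x l.1) * eval_word x u.
Proof. exact: big_cons. Qed.

Lemma eval_word_cat u v : eval_word x (u ++ v) = eval_word x u * eval_word x v.
Proof. exact: big_cat. Qed.

Definition inv_word (u : word I) : word I := rev (map (fun l => (l.1, ~~ l.2)) u).

Lemma eval_inv_word u : eval_word x (inv_word u) = (eval_word x u)^-1.
Proof.
elim: u => [|[i b] u IH]; first by rewrite eval_word_nil invg1.
rewrite /inv_word /= rev_cons -cats1 eval_word_cat eval_word_cons eval_word_nil.
by rewrite -/(inv_word u) IH /= mulg1 eval_word_cons invgM; case: b; rewrite ?invgK.
Qed.

Lemma eval_word_nseq i n : eval_word x (nseq n (i, false)) = x i ^+ n.
Proof. by elim: n => [|n IH]; rewrite ?eval_word_nil // eval_word_cons IH -expgS. Qed.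

Lemma range_eval_word_subgroup : subgroup (range (eval_word x)).
Proof.
apply/subgroupP; split; first by exists [::] => //; apply: eval_word_nil.
move=> _ _ [u _ <-] [v _ <-]; exists (u ++ inv_word v) => //.
by rewrite eval_word_cat eval_inv_word.
Qed.

End EvalWord.

Lemma eval_word_morph (G K : groupType) (f : {multiplicative G -> K}) (I : Type)
    (x : I -> G) u : f (eval_word x u) = eval_word (f \o x) u.
Proof.
elim: u => [|[i b] u IH]; first by rewrite !eval_word_nil multiplicative1.
by rewrite !eval_word_cons gmulfM IH; case: b; rewrite //= multiplicativeV.
Qed.

Definition recursive_in (G : groupType) (I : countType) (x : I -> G) (S : set G) :=
  recursive_set [set u : word I | S (eval_word x u)].

(** Enumerability as the projection of a recursive relation, [c] being a certificate of membership;
    certificates pass through the wreath levels more easily than enumerations. *)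
Definition semirecursive_in (G : groupType) (I : countType) (x : I -> G) (S : set G) :=
  exists2 p : word I -> nat -> bool, computable (fun q : word I * nat => p q.1 q.2)
    & forall u, S (eval_word x u) <-> exists c, p u c.

(* Integers are computed with as differences of natural numbers. *)
Definition zdiff (c : nat * nat) : int := (c.1%:Z - c.2%:Z)%R.
Definition zadd (c d : nat * nat) : nat * nat := ((c.1 + d.1)%N, (c.2 + d.2)%N).

Lemma zdiffD c d : zdiff (zadd c d) = (zdiff c + zdiff d)%R.
Proof. by rewrite /zdiff /=; lia. Qed.

Lemma subz_nat_eq0 (m n : nat) : (m%:Z - n%:Z)%R = 0%R -> m = n.
Proof. lia. Qed.

(** * Decision problems for words over one wreath product *)

Section Level.
Variables (A : groupType) (J I : countType) (y : J -> A) (g : I -> wreath A).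

Definition letter (l : I * bool) := if l.2 then (g l.1)^-1 else g l.1.

(** The section is applied twice: to words in the [gamma x j], with values in [H], and to words in
    [f] and [s], with values in [wreath H]. [emit] spells the coordinates of a letter, [move] gives
    its shift. *)
Variable emit : I * bool -> int -> word J.
Hypothesis eval_emit : forall l n, eval_word y (emit l n) = letter l n.

Fixpoint coord (u : word I) (n : int) : word J :=
  if u is l :: u' then emit l n ++ coord u' (n + wshift (letter l))%R else [::].

Lemma eval_coord u n : eval_word y (coord u n) = eval_word g u n.
Proof.
elim: u n => [|l u IH] n; first by rewrite !eval_word_nil.
by rewrite /= eval_word_cat eval_emit IH eval_word_cons wfunM.
Qed.

Variable move : I * bool -> nat * nat.
Hypothesis zdiff_move : forall l, zdiff (move l) = wshift (letter l).
Hypothesis computable_move : computable move.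
Hypothesis computable_emit :
  computable (fun q : (I * bool) * (nat * nat) => emit q.1 (zdiff q.2)).

Definition total_move (u : word I) := foldl (fun c l => zadd c (move l)) (0%N, 0%N) u.

Lemma zdiff_total_move u : zdiff (total_move u) = wshift (eval_word g u).
Proof.
rewrite /total_move -[RHS]GRing.add0r -[X in (X + _)%R]/(zdiff (0%N, 0%N)).
elim: u (0%N, 0%N) => [|l u IH] c /=; first by rewrite eval_word_nil GRing.addr0.
by rewrite IH zdiffD eval_word_cons wshiftM zdiff_move GRing.addrA.
Qed.

Lemma total_move_eq0 u :
  wshift (eval_word g u) = 0%R <-> (total_move u).1 == (total_move u).2.
Proof.
rewrite -zdiff_total_move /zdiff; split=> [|/eqP ->]; last by rewrite GRing.subrr.
by lia.
Qed.

Lemma total_move_gt0 u :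
  (0 < wshift (eval_word g u))%R <-> ((total_move u).2 < (total_move u).1)%N.
Proof. by rewrite -zdiff_total_move /zdiff; lia. Qed.

Lemma computable_zadd (T : countType) (c d : T -> nat * nat) :
  computable c -> computable d -> computable (fun x => zadd (c x) (d x)).
Proof. by rewrite /zadd => cC dC; computability. Qed.

Lemma computable_total_move : computable total_move.
Proof.
apply: (computable_foldl (g := fun c l _ => zadd c (move l))); computability.
by apply: computable_zadd; last apply: (computable_comp computable_move); computability.
Qed.

Lemma computable_coord :
  computable (fun q : word I * (nat * nat) => coord q.1 (zdiff q.2)).
Proof.
pose step (acc : word J * (nat * nat)) l :=
  (acc.1 ++ emit l (zdiff acc.2), zadd acc.2 (move l)).
have -> : (fun q : word I * (nat * nat) => coord q.1 (zdiff q.2)) =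
    (fun q => (foldl step ([::], q.2) q.1).1).
  apply/funext => -[u c] /=; rewrite -[LHS]cat0s.
  elim: u c [::] => [|l u IH] c o /=; first by rewrite cats0.
  by rewrite -IH -catA zdiffD zdiff_move.
apply: computable_fst; apply: (computable_foldl (g := fun acc l _ => step acc l)).
- by computability.
- by computability.
pose Q := (word J * (nat * nat) * (I * bool) * (word I * (nat * nat)))%type.
have C1 : computable (fun q : Q => q.1.1.2) by computability.
have C2 : computable (fun q : Q => q.1.2) by computability.
rewrite /step; apply: computable_pair.
  apply: computable_cat; first by computability.
  exact: (computable_comp computable_emit (computable_pair C2 C1)).
exact: computable_zadd C1 (computable_comp computable_move C2).
Qed.

Variable range_size : nat -> nat.
Hypothesis computable_range_size : computable range_size.
Hypothesis coord_low : forall (u : word I) n,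
  (n < - (size u)%:Z)%R -> eval_word g u n = 1.
(** Nontriviality shows within a range computed from the length alone. Index [size u] is coordinate
    0; the last clause keeps a nontrivial coordinate other than 0 from being witnessed there, as is
    needed to test whether an element is concentrated at 0. *)
Hypothesis coord_range : forall (u : word I) n, eval_word g u n <> 1 ->
  exists k, [/\ (k < range_size (size u))%N,
    eval_word g u (k%:Z - (size u)%:Z)%R <> 1 & n <> 0%R -> k <> size u].

(* Coordinates are numbered from [- size u], left of which all are trivial. *)
Definition ith_coord (u : word I) k := coord u (zdiff (k, size u)).

Lemma eval_ith_coord u k :
  eval_word y (ith_coord u k) = eval_word g u (k%:Z - (size u)%:Z)%R.
Proof. exact: eval_coord. Qed.

Lemma computable_ith_coord (T : countType) (u : T -> word I) (k : T -> nat) :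
  computable u -> computable k -> computable (fun x => ith_coord (u x) (k x)).
Proof.
move=> uC kC; apply: (computable_comp computable_coord (f := fun x => (u x, (k x, size (u x))))).
by computability.
Qed.

(** Covers two problems at once: [M = [set 1]] gives triviality, and nesting it twice around [setT]
    gives the image of [H]. *)
Definition base_at (M : set A) : set (wreath A) :=
  [set w | [/\ wshift w = 0%R, forall n, n <> 0%R -> w n = 1 & M (w 0%R)]].

Lemma recursive_base_at (M : set A) :
  recursive_in y [set 1] -> recursive_in y M -> recursive_in g (base_at M).
Proof.
move=> [t tC tE] [d dC dE].
pose p u (k : nat) := (k == size u :> nat) || t (ith_coord u k).
exists (fun u => [&& (total_move u).1 == (total_move u).2,
    all (p u) (iota 0 (range_size (size u))) & d (ith_coord u (size u))]).
  have C := computable_total_move.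
  have R : computable (fun u : word I => iota 0 (range_size (size u))).
    by computability; apply: (computable_comp computable_range_size); computability.
  apply: computable_andb; [|apply: computable_andb].
  - by computability.
  - apply: (computable_all (p := fun k u => p u k)) => //; rewrite /p; computability.
    by apply: (computable_comp tC); apply: computable_ith_coord; computability.
  - by apply: (computable_comp dC); apply: computable_ith_coord; computability.
move=> u; have d0 : M (eval_word g u 0%R) <-> d (ith_coord u (size u)).
  by rewrite -dE /= eval_ith_coord GRing.subrr.
have t1 k : t (ith_coord u k) <-> eval_word g u (k%:Z - (size u)%:Z)%R = 1.
  by rewrite -tE /= eval_ith_coord.
split=> [[u0 u1 Mu]|/and3P[u0 /allP u1 Mu]].
  apply/and3P; split; [exact/total_move_eq0 | | exact/d0].
  by apply/allP => k _; rewrite /p; case: eqP => //= nk; apply/t1/u1 => /subz_nat_eq0.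
split; [exact/total_move_eq0 | | exact/d0].
move=> n n0; apply: contrapT => /coord_range[k [ltk kn1 /(_ n0) nk]].
by have := u1 k; rewrite mem_iota ltk /p => /(_ isT)/orP[/eqP//|/t1].
Qed.

Lemma base_at1 : base_at [set 1] = [set 1].
Proof.
apply/seteqP; split=> [w [w0 w1 w01]|_ -> //]; apply: wreath_eq => // n.
by case: (n =P 0%R) => [->|/w1].
Qed.

Lemma recursive_triv : recursive_in y [set 1] -> recursive_in g [set 1].
Proof. by move=> t; have := recursive_base_at t t; rewrite base_at1. Qed.

(** A certificate for a word is the code of a list of certificates, one for each coordinate in the
    range. *)
Lemma semirecursive_triv : semirecursive_in y [set 1] -> semirecursive_in g [set 1].
Proof.
move=> [p pC pE].
pose certified u c (k : nat) := p (ith_coord u k) (nth 0%N (CodeSeq.decode c) k).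
exists (fun u c => ((total_move u).1 == (total_move u).2)
    && all (certified u c) (iota 0 (range_size (size u)))).
  have C : computable (fun q : word I * nat => total_move q.1).
    by apply: (computable_comp computable_total_move); computability.
  apply: computable_andb; first by computability.
  apply: (computable_all (p := fun k q => certified q.1 q.2 k)).
    by computability; apply: (computable_comp computable_range_size); computability.
  apply: (computable_comp pC (f := fun q : nat * (word I * nat) =>
    (ith_coord q.2.1 q.1, nth 0%N (CodeSeq.decode q.2.2) q.1))).
  by computability; apply: computable_ith_coord; computability.
move=> u; have p1 k : eval_word g u (k%:Z - (size u)%:Z)%R = 1 <->
    exists c, p (ith_coord u k) c.
  by rewrite -pE /= eval_ith_coord.
split=> [u1|[c /andP[u0 /allP u1]]].
  have /choice[c cP] : forall k, exists c, p (ith_coord u k) c.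
    by move=> k; apply/p1; rewrite u1.
  exists (CodeSeq.code (mkseq c (range_size (size u)))); apply/andP; split.
    by apply/total_move_eq0; rewrite u1.
  apply/allP => k; rewrite mem_iota /certified CodeSeq.codeK => /andP[_ ltk].
  by rewrite nth_mkseq.
apply: wreath_eq => [n|]; last exact/total_move_eq0.
apply: contrapT => /coord_range[k [ltk kn1 _]]; apply: kn1; apply/p1.
by exists (nth 0%N (CodeSeq.decode c) k); apply: u1; rewrite mem_iota.
Qed.

(** The fold scans for the first nontrivial word and returns its test by [d]; if there is none, the
    value [true] agrees with [P 1]. *)
Lemma first_nontrivial (P : set A) (t d : word J -> bool) (v : nat -> word J) :
  P 1 -> (forall w, eval_word y w = 1 <-> t w) -> (forall w, P (eval_word y w) <-> d w) ->
  forall i m, foldr (fun k acc => if t (v k) then acc else d (v k)) true (iota i m) <->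
    forall k, (i <= k < i + m)%N ->
      (forall j, (i <= j < k)%N -> eval_word y (v j) = 1) -> P (eval_word y (v k)).
Proof.
move=> P1 tE dE i m; elim: m i => [|m IH] i /=.
  by split=> // _ k; lia.
case: ifPn => [/tE ti|nti].
  rewrite IH; split=> H k lek triv.
    case: (ltngtP i k) => [ltik|?|<-]; [|lia|by rewrite ti].
    by apply: H => [|j lej]; [lia | apply: triv; lia].
  apply: H => [|j lej]; first lia.
  by case: (ltngtP i j) => [ltij|?|<-//]; [apply: triv; lia | lia].
rewrite -dE; split=> [Pi k lek triv|]; last by apply; lia.
case: (ltngtP i k) => [ltik|?|<-//]; last lia.
by case/negP: nti; apply/tE/triv; lia.
Qed.

(** Reduces the condition in [wreath_cone] to a finite window: nothing is nontrivial left of it, and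
    any nontrivial coordinate entails one inside, so the leftmost one lies inside. *)
Lemma leftmost_range (P : set A) (w : wreath A) (N b : nat) : P 1 ->
  (forall n : int, (n < - N%:Z)%R -> w n = 1) ->
  (forall n, w n <> 1 -> exists2 k, (k < b)%N & w (k%:Z - N%:Z)%R <> 1) ->
  (forall k : nat, (0 <= k < 0 + b)%N ->
    (forall j : nat, (0 <= j < k)%N -> w (j%:Z - N%:Z)%R = 1) -> P (w (k%:Z - N%:Z)%R)) <->
  (forall n : int, (forall k : int, (k < n)%R -> w k = 1) -> P (w n)).
Proof.
move=> P1 low range; split=> H; last first.
  move=> k ltk triv; apply: H => n ltn.
  case: (ltP n (- N%:Z)%R) => [/low//|len].
  have nE : n = ((absz (n + N%:Z)%R)%:Z - N%:Z)%R by lia.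
  by rewrite nE; apply: triv; lia.
move=> n lt1; case: (pselect (w n = 1)) => [-> //|n1].
have len : (- N%:Z <= n)%R by rewrite leNgt; apply/negP => /low.
have nE : n = ((absz (n + N%:Z)%R)%:Z - N%:Z)%R by lia.
rewrite nE; apply: H => [|j ltj]; last by apply: lt1; lia.
have [k ltk kn1] := range n n1; rewrite add0n /=.
apply: leq_ltn_trans ltk; rewrite leqNgt; apply/negP => ltk.
by apply: kn1; apply: lt1; lia.
Qed.

Lemma recursive_wreath_cone (P : set A) : P 1 ->
  recursive_in y [set 1] -> recursive_in y P -> recursive_in g (wreath_cone P).
Proof.
move=> P1 [t tC tE] [d dC dE].
pose first u := foldr (fun (k : nat) acc =>
  if t (ith_coord u k) then acc else d (ith_coord u k)) true (iota 0 (range_size (size u))).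
exists (fun u => ((total_move u).2 < (total_move u).1)%N
    || ((total_move u).1 == (total_move u).2) && first u).
  have C := computable_total_move.
  computability.
  apply: (computable_foldr (g := fun k acc u =>
    if t (ith_coord u k) then acc else d (ith_coord u k))).
  - by computability; apply: (computable_comp computable_range_size); computability.
  - by computability.
  have C' : computable (fun q : nat * bool * word I => ith_coord q.2 q.1.1).
    by apply: computable_ith_coord; computability.
  apply: computable_if; [exact: computable_comp tC C' | | exact: computable_comp dC C'].
  by computability.
move=> u; have firstE : first u <->
    forall n : int, (forall k : int, (k < n)%R -> eval_word g u k = 1) -> P (eval_word g u n).
  rewrite /first (first_nontrivial (ith_coord u) P1 tE dE).
  rewrite -(leftmost_range P1 (@coord_low u) (N := size u) (b := range_size (size u))).
    by split=> H k ltk triv; have := H k ltk; rewrite eval_ith_coord; apply=> j ltj;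
      first [rewrite eval_ith_coord | rewrite -eval_ith_coord]; apply: triv.
  by move=> n /coord_range[k [ltk nk _]]; exists k.
rewrite /wreath_cone /= total_move_gt0; split.
  case=> [->//|[/total_move_eq0 -> H]]; apply/orP; right; exact/firstE.
by case/orP => [|/andP[/total_move_eq0 ? /firstE ?]]; [left|right].
Qed.

End Level.
(** * Recursively enumerable sets of words *)

(** A certificate is a position in the enumeration. The empty word represents 1, so [S 1] excludes
    the empty set. *)
Lemma semirecursive_of_re (G : groupType) (I : countType) (x : I -> G) (S : set G) :
  S 1 -> re_set [set u : word I | S (eval_word x u)] -> semirecursive_in x S.
Proof.
move=> S1 [S0|[e eC eE]].
  by have : set0 ([::] : word I) by rewrite -S0 /= eval_word_nil.
exists (fun u c => e c == u).
  by computability; apply: (computable_comp eC); computability.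
move=> u; rewrite -[S _]/([set u : word I | S (eval_word x u)] u) -eE.
by split=> [[c _ <-]|[c /eqP <-]]; exists c.
Qed.

(** A total map from numbers onto words, used to enumerate them: each letter is read from a pair of
    an index code, decoded by [d], and a sign. *)
Definition word_of_code (I : countType) (d : nat -> I) (c : nat) : word I :=
  map (fun k => (d (nth 0%N (CodeSeq.decode k) 0), odd (nth 0%N (CodeSeq.decode k) 1)))
    (CodeSeq.decode c).

Lemma computable_word_of_code (I : countType) (d : nat -> I) :
  computable d -> computable (word_of_code d).
Proof.
move=> dC; apply: (computable_map (g := fun (k c : nat) =>
  (d (nth 0%N (CodeSeq.decode k) 0), odd (nth 0%N (CodeSeq.decode k) 1)))).
  exact: computable_decode.
by computability; apply: (computable_comp dC); computability.
Qed.

Lemma word_of_code_surj (I : countType) (d : nat -> I) (d' : I -> nat) :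
  cancel d' d -> forall u, exists c, word_of_code d c = u.
Proof.
move=> d'K u; exists (CodeSeq.code (map (fun l : I * bool => code_pair (d' l.1) l.2) u)).
rewrite /word_of_code CodeSeq.codeK -map_comp -[RHS]map_id; apply: eq_map => -[i b].
by rewrite /= /code_pair CodeSeq.codeK /= d'K oddb.
Qed.

(** Run through all pairs of a word and a candidate certificate. If the candidate fails, output the
    empty word, which belongs to the set by [S 1]. *)
Lemma re_of_semirecursive (G : groupType) (I : countType) (x : I -> G) (S : set G)
    (d : nat -> I) (d' : I -> nat) : computable d -> cancel d' d ->
  S 1 -> semirecursive_in x S -> re_set [set u : word I | S (eval_word x u)].
Proof.
move=> dC d'K S1 [p pC pE]; right.
pose u k := word_of_code d (nth 0%N (CodeSeq.decode k) 0).
pose c k := nth 0%N (CodeSeq.decode k) 1.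
exists (fun k => if p (u k) (c k) then u k else [::]).
  have uC : computable u.
    by apply: (computable_comp (computable_word_of_code dC)); computability.
  apply: computable_if; computability.
  apply: (computable_comp pC (f := fun k => (u k, c k))).
  by rewrite /c; computability.
apply/seteqP; split=> [_ [k _ <-]|v].
  by case: ifP => [pk|_] /=; [apply/pE; exists (c k) | rewrite eval_word_nil].
move=> /pE[n pn]; have [m mE] := word_of_code_surj d'K v.
exists (code_pair m n) => //.
by rewrite /u /c /code_pair CodeSeq.codeK /= mE pn.
Qed.

Definition subst_word (I J : Type) (w : I -> word J) (u : word I) : word J :=
  foldr (fun l v => (if l.2 then inv_word (w l.1) else w l.1) ++ v) [::] u.

Lemma eval_subst_word (G K : groupType) (I J : Type) (x : I -> G) (y : J -> K)
    (f : {multiplicative G -> K}) (w : I -> word J) u :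
  (forall i, eval_word y (w i) = f (x i)) ->
  eval_word y (subst_word w u) = f (eval_word x u).
Proof.
move=> wE; rewrite eval_word_morph; elim: u => [|[i b] u IH]; first by rewrite !eval_word_nil.
rewrite [subst_word _ _]/= eval_word_cat eval_word_cons; congr (_ * _); last exact: IH.
by case: b; rewrite /= ?eval_inv_word wE.
Qed.

Lemma computable_inv_word (I T : countType) (u : T -> word I) :
  computable u -> computable (fun x => inv_word (u x)).
Proof.
move=> uC; apply: computable_rev.
by apply: (computable_map (g := fun (l : I * bool) (_ : T) => (l.1, ~~ l.2))); computability.
Qed.

Lemma computable_subst_word (I J : countType) (w : I -> word J) :
  computable w -> computable (subst_word w).
Proof.
move=> wC; apply: (computable_foldr (g := fun (l : I * bool) v (_ : word I) =>
  (if l.2 then inv_word (w l.1) else w l.1) ++ v)); computability.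
have C : computable (fun q : I * bool * word J * word I => w q.1.1.1).
  by apply: (computable_comp wC); computability.
by apply: computable_if => //; [computability | apply: computable_inv_word].
Qed.

Lemma recursive_set_preimage (T U : countType) (f : T -> U) (B : set U) :
  computable f -> recursive_set B -> recursive_set [set t | B (f t)].
Proof.
by move=> fC [d dC dE]; exists (fun t => d (f t)) => [|t]; [apply: computable_comp | apply: dE].
Qed.

(** * The two generators *)

(* [npos n] is the positive part of [n]; it is a power of two iff its code is
   that of a one-element sequence. *)
Definition npos (n : int) : nat := if n is Posz k then k else 0%N.
Definition log2 (n : int) : nat := code_head (npos n).
Definition is_pow2 (n : int) : bool := (2 ^ log2 n == npos n)%N.

Lemma is_pow2P n : reflect (exists j, n = (Posz (2 ^ j)%N)) (is_pow2 n).
Proof.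
apply: (iffP eqP) => [E|[j ->]].
  exists (log2 n); rewrite E; case: n E => [//|k] E.
  by have := expn_gt0 2 (log2 (Negz k)); rewrite [X in (_ < X)%N]E.
by rewrite /log2 /= -[X in code_head X]muln1 (code_headE j [::]).
Qed.

Lemma log2_exp j : log2 (Posz (2 ^ j)%N) = j.
Proof. by rewrite /log2 /= -[X in code_head X]muln1 (code_headE j [::]). Qed.

Lemma is_pow2_exp j : is_pow2 (Posz (2 ^ j)%N).
Proof. by apply/is_pow2P; exists j. Qed.

Lemma is_pow2_gt0 n : is_pow2 n -> (0 < n)%R.
Proof. by move=> /is_pow2P[j ->]; have := expn_gt0 2 j; lia. Qed.

(** Distinct powers of two differ by at least the smaller one, so a short window far to the right
    meets at most one of them. *)
Lemma is_pow2_gap m n : is_pow2 m -> is_pow2 n -> (m < n)%R -> (m + m <= n)%R.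
Proof.
move=> /is_pow2P[i ->] /is_pow2P[j ->] ltij.
have {}ltij : (i < j)%N by rewrite -(ltn_exp2l _ _ (ltnSn 1)); lia.
by have := leq_pexp2l (ltn0Sn 1) ltij; rewrite expnS; lia.
Qed.

Section Generators.
Variables (H : groupType) (x : nat -> H).

(* [gamma 0] is the shift [t]; [gamma i.+1] is the product of [t] with the step
   function equal to [x i] at positive integers.  The factor [t] ensures that
   all values of [f] on its support have infinite order. *)
Definition gamma_fun (j : nat) (m : int) : H :=
  if (j != 0%N) && (0 < m)%R then x j.-1 else 1.

Fact gamma_bounded j : exists N : int, forall m : int, (m < N)%R -> gamma_fun j m = 1.
Proof.
by exists 0%R => m ltm; rewrite /gamma_fun; case: (ltP 0%R m); rewrite ?andbF //; lia.
Qed.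

Definition gamma j : wreath H := Wreath 1%R (gamma_bounded j).

Definition fgen_fun (n : int) : wreath H := if is_pow2 n then gamma (log2 n) else 1.

Fact fgen_bounded : exists N : int, forall n : int, (n < N)%R -> fgen_fun n = 1.
Proof.
by exists 0%R => n ltn; rewrite /fgen_fun; case: ifP => // /is_pow2_gt0; lia.
Qed.

Definition fgen : wreath (wreath H) := Wreath 0%R fgen_bounded.
Definition sgen : wreath (wreath H) := wreath_shift _ 1%R.

Lemma fgen_exp j : fgen_fun (Posz (2 ^ j)%N) = gamma j.
Proof. by rewrite /fgen_fun is_pow2_exp log2_exp. Qed.

(* Commuting with [gamma 0 = t] isolates the jump of [gamma i.+1] at [0]. *)
Lemma gamma_comm i : gamma 0 * gamma i.+1 * (gamma 0)^-1 * (gamma i.+1)^-1 = wdelta (x i).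
Proof.
apply: wreath_eq => [m|] //; rewrite !wreathE /= /gamma_fun /= mul1g invg1 mulg1.
have -> : (m + (1 + 1 - 1) - 1)%R = m by lia.
case: (ltgtP 0%R m) => [gt0|lt0|<-] /=.
- have -> : (0 < m + 1)%R by lia.
  by rewrite mulgV.
- have -> : (0 < m + 1)%R = false by lia.
  by rewrite mul1g invg1.
- by rewrite invg1 mulg1.
Qed.
End Generators.

(** * Coordinates of words in the elements [gamma x j] *)

Section InnerLevel.
Variables (H : groupType) (x : nat -> H).

(** The bound [Posz l.2] is 0 for a letter and 1 for its inverse, whose coordinate [m] is the
    inverse of the value at [m - 1]. *)
Definition gamma_emit (l : nat * bool) (m : int) : word nat :=
  if (l.1 != 0%N) && (Posz l.2 < m)%R then [:: (l.1.-1, l.2)] else [::].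

Definition gamma_move (l : nat * bool) : nat * nat :=
  if l.2 then (0%N, 1%N) else (1%N, 0%N).

Lemma letter_gamma l m :
  letter (gamma x) l m = (if l.2 then (gamma_fun x l.1 (m - 1)%R)^-1 else gamma_fun x l.1 m).
Proof. by case: l => j []. Qed.

Lemma wshift_letter_gamma l :
  wshift (letter (gamma x) l) = if l.2 then (-1)%R else 1%R.
Proof. by case: l => j []. Qed.

Lemma eval_gamma_emit l m : eval_word x (gamma_emit l m) = letter (gamma x) l m.
Proof.
rewrite letter_gamma /gamma_emit /gamma_fun; case: l => [[|j] []] /=.
- by rewrite eval_word_nil invg1.
- by rewrite eval_word_nil.
- have -> : (0 < m - 1)%R = (1 < m)%R by lia.
  by case: ifP => _; rewrite ?eval_word_cons eval_word_nil ?mulg1 ?invg1.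
- by case: ifP => _; rewrite ?eval_word_cons eval_word_nil ?mulg1.
Qed.

Lemma zdiff_gamma_move l : zdiff (gamma_move l) = wshift (letter (gamma x) l).
Proof. by case: l => j []. Qed.

Lemma computable_gamma_move : computable gamma_move.
Proof. by apply: computable_if; computability. Qed.

Lemma computable_gamma_emit :
  computable (fun q : (nat * bool) * (nat * nat) => gamma_emit q.1 (zdiff q.2)).
Proof.
have -> : (fun q : (nat * bool) * (nat * nat) => gamma_emit q.1 (zdiff q.2)) =
    (fun q => if (q.1.1 != 0%N) && ((q.2.2 + pickle q.1.2).+1 <= q.2.1)%N
              then [:: (q.1.1.-1, q.1.2)] else [::]).
  apply/funext => -[[j b] [c d]]; rewrite /gamma_emit /zdiff /=.
  have -> // : (Posz b < Posz c - Posz d)%R = (d + b < c)%N by lia.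
have C : computable (fun q : (nat * bool) * (nat * nat) => pickle q.1.2).
  by apply: (computable_comp (computable_pickle _)); computability.
by apply: computable_if; computability.
Qed.

Lemma gamma_low (v : word nat) (n : int) :
  (n < - (size v)%:Z)%R -> eval_word (gamma x) v n = 1.
Proof.
move=> ltn; have {ltn} : (n + (size v)%:Z <= 0)%R by lia.
elim: v n => [|l v IH] n; first by rewrite eval_word_nil.
rewrite eval_word_cons wfunM -/(letter _ l) letter_gamma wshift_letter_gamma => len.
have /= {len} len : (n + (size v).+1%:Z <= 0)%R by [].
rewrite IH; last by case: l.2; lia.
have low m : (m <= 0)%R -> gamma_fun x l.1 m = 1.
  by move=> lem; rewrite /gamma_fun (ltNge 0%R) lem andbF.
by case: l.2; rewrite low ?invg1 ?mulg1 //; lia.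
Qed.

(** The step functions are constant on positive integers, and a word shifts by at most its
    length. *)
Lemma gamma_high (v : word nat) (m n : int) : ((size v)%:Z < m)%R -> ((size v)%:Z < n)%R ->
  eval_word (gamma x) v m = eval_word (gamma x) v n.
Proof.
elim: v m n => [|l v IH] m n; first by rewrite eval_word_nil.
rewrite eval_word_cons !wfunM -/(letter _ l) !letter_gamma wshift_letter_gamma => ltm ltn.
have /= {}ltm : ((size v).+1%:Z < m)%R by [].
have /= {}ltn : ((size v).+1%:Z < n)%R by [].
have high k : (0 < k)%R -> gamma_fun x l.1 k = gamma_fun x l.1 1%R.
  by move=> ltk; rewrite /gamma_fun ltk.
congr (_ * _); last by apply: IH; case: l.2; lia.
by case: l.2; rewrite !(high _, high (_ - _)%R) //; lia.
Qed.

(** Indices of the coordinates from -N to N + 1; the last one stands for all those beyond N, where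
    the values agree. *)
Definition gamma_range (N : nat) : nat := (N + N).+2.

Lemma computable_gamma_range : computable gamma_range.
Proof. by rewrite /gamma_range; computability. Qed.

Lemma gamma_coord_range (v : word nat) n : eval_word (gamma x) v n <> 1 ->
  exists k, [/\ (k < gamma_range (size v))%N,
    eval_word (gamma x) v (k%:Z - (size v)%:Z)%R <> 1 & n <> 0%R -> k <> size v].
Proof.
move=> n1; have low := @gamma_low v n; have high := @gamma_high v n.
move: (size v) low high => N low high.
have len : (- N%:Z <= n)%R by rewrite leNgt; apply/negP => /low.
case: (leP n (Posz N)) => ltn.
  have nE : (Posz (absz (n + N%:Z)%R) - N%:Z)%R = n by lia.
  exists (absz (n + N%:Z)%R); rewrite nE /gamma_range; split=> //; lia.
exists (N + N).+1; split; [by [] | | by lia].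
by rewrite -(high _ ltn) //; lia.
Qed.

End InnerLevel.

(** * Coordinates of words in [f] and [s] *)

Section OuterLevel.
Variables (H : groupType) (x : nat -> H).
Let fs := pair_gen (fgen x) (sgen H).

Definition fs_emit (l : bool * bool) (n : int) : word nat :=
  if ~~ l.1 && is_pow2 n then [:: (log2 n, l.2)] else [::].

Definition fs_move (l : bool * bool) : nat * nat :=
  if l.1 then (if l.2 then (0%N, 1%N) else (1%N, 0%N)) else (0%N, 0%N).

Lemma letter_fs l n :
  letter fs l n = if l.1 then 1 else if l.2 then (fgen_fun x n)^-1 else fgen_fun x n.
Proof.
case: l => [[] []] //; rewrite /letter /= ?wfunV /= ?invg1 ?GRing.subr0 //.
Qed.

Lemma wshift_letter_fs l :
  wshift (letter fs l) = if l.1 then (if l.2 then (-1)%R else 1%R) else 0%R.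
Proof. by case: l => [[] []]. Qed.

Lemma eval_fs_emit l n : eval_word (gamma x) (fs_emit l n) = letter fs l n.
Proof.
rewrite letter_fs /fs_emit /fgen_fun; case: l => [[] b] /=; first exact: eval_word_nil.
case: ifP => _; rewrite ?eval_word_cons eval_word_nil /= ?mulg1 //.
by rewrite invg1; case: b.
Qed.

Lemma zdiff_fs_move l : zdiff (fs_move l) = wshift (letter fs l).
Proof. by case: l => [[] []]. Qed.

Lemma computable_fs_move : computable fs_move.
Proof.
by apply: computable_if; computability; apply: computable_if; computability.
Qed.

Lemma computable_fs_emit :
  computable (fun q : (bool * bool) * (nat * nat) => fs_emit q.1 (zdiff q.2)).
Proof.
pose p (q : (bool * bool) * (nat * nat)) := (q.2.1 - q.2.2)%N.
have -> : (fun q : (bool * bool) * (nat * nat) => fs_emit q.1 (zdiff q.2)) =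
    (fun q => if ~~ q.1.1 && (2 ^ code_head (p q) == p q)%N
              then [:: (code_head (p q), q.1.2)] else [::]).
  apply/funext => -[[a b] [c d]]; rewrite /fs_emit /is_pow2 /log2 /p /=.
  have -> // : npos (zdiff (c, d)) = (c - d)%N.
  rewrite /zdiff /=; case E : (Posz c - Posz d)%R => /=; lia.
have pC : computable p by rewrite /p; computability.
have C : computable (fun q => code_head (p q)).
  exact: computable_comp (computable_rec1 rec1_code_head) pC.
by apply: computable_if; computability.
Qed.

(** Coordinate [n] of a word involves only values of [f] at distance at most [size u] from [n]. *)
Lemma fs_no_pow2 (u : word bool) (n : int) :
  (forall m : int, (`|m - n| <= (size u)%:Z)%R -> ~~ is_pow2 m) -> eval_word fs u n = 1.
Proof.
elim: u n => [|l u IH] n nopow; first by rewrite eval_word_nil.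
have {}nopow m : (`|m - n| <= (size u).+1%:Z)%R -> ~~ is_pow2 m by apply: nopow.
rewrite eval_word_cons wfunM -/(letter _ l) letter_fs wshift_letter_fs IH.
  have pn : is_pow2 n = false by apply/negbTE/nopow; lia.
  by rewrite /fgen_fun pn invg1 !if_same mulg1.
by move=> m lem; apply: nopow; move: lem; case: l.1; case: l.2; lia.
Qed.

Lemma fs_low (u : word bool) (n : int) :
  (n < - (size u)%:Z)%R -> eval_word fs u n = 1.
Proof.
move=> ltn; apply: fs_no_pow2 => m lem; apply/negP => /is_pow2_gt0.
by move: (size u) ltn lem => N; lia.
Qed.

(** [Negz k] is -(k + 1), whence the exponent [k.+1]. *)
Definition gamma_exp j (e : int) : wreath H :=
  if e is Negz k then (gamma x j)^-1 ^+ k.+1 else gamma x j ^+ absz e.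

Lemma gamma_expS j e : gamma x j * gamma_exp j e = gamma_exp j (e + 1)%R.
Proof.
case: e => [k|[|k]].
- have -> : (Posz k + 1)%R = Posz k.+1 by lia.
  by rewrite /= expgS.
- by rewrite /= mulgV.
- have -> : (Negz k.+1 + 1)%R = Negz k by lia.
  by rewrite /= expgS mulVKg.
Qed.

Lemma gamma_expP j e : (gamma x j)^-1 * gamma_exp j e = gamma_exp j (e - 1)%R.
Proof. by rewrite -{1}(GRing.subrK 1%R e) -gamma_expS mulKg. Qed.

(** Only powers of one [gamma x j] are multiplied; as it has shift 1, the total exponent is the
    shift of the product. *)
Lemma fs_single_pow2 (u : word bool) (n : int) j :
  (forall m : int, (`|m - n| <= (size u)%:Z)%R -> is_pow2 m -> m = Posz (2 ^ j)%N) ->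
  eval_word fs u n = gamma_exp j (wshift (eval_word fs u n)).
Proof.
elim: u n => [|l u IH] n onepow; first by rewrite eval_word_nil.
have {}onepow (m : int) : (`|m - n| <= (size u).+1%:Z)%R -> is_pow2 m ->
    m = Posz (2 ^ j)%N by apply: onepow.
rewrite eval_word_cons wfunM -/(letter _ l) letter_fs wshift_letter_fs wshiftM.
have {}IH := IH (n + (if l.1 then if l.2 then -1 else 1 else 0))%R.
rewrite [X in _ * X = _]IH; last first.
  by move=> m lem; apply: onepow; move: lem; case: l.1; case: l.2; lia.
move: (wshift (wfun (eval_word _ _) _)) => e; rewrite /fgen_fun.
have log_n : is_pow2 n -> log2 n = j.
  by move=> pn; rewrite (onepow n _ pn) ?log2_exp //; lia.
case: l.1; first by rewrite mul1g wshift1 GRing.add0r.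
case pn: (is_pow2 n); last by rewrite invg1 if_same mul1g wshift1 GRing.add0r.
rewrite (log_n pn); case: l.2; last by rewrite gamma_expS /= GRing.addrC.
by rewrite gamma_expP wshiftV /= GRing.addrC.
Qed.

(** Every [gamma x j] has the same shift 1, so the shift of a coordinate depends only on where the
    powers of two lie in its window, not on which they are. *)
Lemma fs_wshift_eq (u : word bool) (m n : int) :
  (forall d : int, (`|d| <= (size u)%:Z)%R -> is_pow2 (m + d)%R = is_pow2 (n + d)%R) ->
  wshift (eval_word fs u m) = wshift (eval_word fs u n).
Proof.
elim: u m n => [|l u IH] m n same; first by rewrite eval_word_nil.
have {}same (d : int) : (`|d| <= (size u).+1%:Z)%R ->
    is_pow2 (m + d)%R = is_pow2 (n + d)%R by apply: same.
rewrite eval_word_cons !wfunM -/(letter _ l) !letter_fs wshift_letter_fs !wshiftM.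
congr (_ + _)%R; last first.
  apply: IH => d led; rewrite -!GRing.addrA; apply: same.
  by case: l.1; case: l.2; lia.
have := same 0%R; rewrite !GRing.addr0 /fgen_fun => -> //.
by case: l.1 => //; case: l.2; case: ifP.
Qed.

(** Indices of the coordinates from -N to 2^(4N) + N. Since 2^(4N) > 4N, every other power of two is
    more than 2N away from 2^(4N). *)
Definition fs_range (N : nat) : nat := (2 ^ (N + N + N + N) + (N + N)).+1.

Lemma computable_fs_range : computable fs_range.
Proof. by rewrite /fs_range; computability. Qed.

(* Far to the right, the support of [f] meets a window of radius [size u] in at
   most one point [2 ^ i]; by translation, the same total exponent of [t] then
   occurs near [2 ^ (4 * size u)], and it decides whether the value is trivial. *)
Lemma fs_coord_range (u : word bool) n : eval_word fs u n <> 1 ->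
  exists k, [/\ (k < fs_range (size u))%N,
    eval_word fs u (k%:Z - (size u)%:Z)%R <> 1 & n <> 0%R -> k <> size u].
Proof.
move=> n1; have low := @fs_low u; have none := @fs_no_pow2 u n.
have single := @fs_single_pow2 u n; have shift := @fs_wshift_eq u.
rewrite /fs_range; move: (size u) low none single shift => N low none single shift.
have len : (- N%:Z <= n)%R by rewrite leNgt; apply/negP => /low.
have big : (N + N + N + N < 2 ^ (N + N + N + N))%N by rewrite ltn_expl.
set J := (N + N + N + N)%N in big *.
have powJ := is_pow2_exp J.
case: (leP n ((2 ^ J)%N%:Z + N%:Z)%R) => ltn.
  have nE : (Posz (absz (n + N%:Z)%R) - N%:Z)%R = n by lia.
  by exists (absz (n + N%:Z)%R); rewrite nE; split=> //; lia.
have [m lem pm] : exists2 m : int, (`|m - n| <= N%:Z)%R & is_pow2 m.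
  by apply: contrapT => nom; apply/n1/none => m lem; apply/negP => pm; apply: nom; exists m.
(* Two powers of two in the window differ by at most 2N, but both exceed 2^J > 4N, and so would
   their distance. *)
have uniq m' : (`|m' - n| <= N%:Z)%R -> is_pow2 m' -> m' = m.
  move=> lem' pm'; case: (ltgtP m' m) => // lt.
    by have := is_pow2_gap pm' pm lt; rewrite /J in ltn big; lia.
  by have := is_pow2_gap pm pm' lt; rewrite /J in ltn big; lia.
have /is_pow2P[j mE] := pm.
(* The window around [n] is translated so that its power of two [m] lands on 2^J. *)
pose n' := (n - m + Posz (2 ^ J)%N)%R.
have uniq' m' : (`|m' - n'| <= N%:Z)%R -> is_pow2 m' -> m' = Posz (2 ^ J)%N.
  move=> lem' pm'; case: (ltgtP m' (Posz (2 ^ J)%N)) => // lt.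
    by have := is_pow2_gap pm' powJ lt; rewrite /n' /J in lem' big *; lia.
  by have := is_pow2_gap powJ pm' lt; rewrite /n' /J in lem' big *; lia.
have shiftE : wshift (eval_word fs u n) = wshift (eval_word fs u n').
  apply: shift => d led; apply/idP/idP => p.
    have E := uniq (n + d)%R _ p.
    have -> : (n' + d)%R = Posz (2 ^ J)%N by rewrite /n'; lia.
    exact: powJ.
  have E := uniq' (n' + d)%R _ p.
  have -> : (n + d)%R = m by move: E; rewrite /n'; lia.
  exact: pm.
(* If coordinate [n'] were trivial, its shift would be 0; coordinate [n], a power of [gamma x j]
   with that exponent, would be trivial too. *)
have n'1 : eval_word fs u n' <> 1.
  move=> n'1; apply: n1; rewrite (single j) ?shiftE ?n'1 //.
  by move=> m' lem' pm'; rewrite -mE; apply: uniq.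
have nE : (Posz (absz (n' + N%:Z)%R) - N%:Z)%R = n' by rewrite /n'; lia.
(* The index differs from N because n' >= 2^J - N > 0. *)
exists (absz (n' + N%:Z)%R); rewrite nE; split=> //; rewrite /n' /J in big *; lia.
Qed.

End OuterLevel.
(** * The subgroup generated by a family *)

Section Span.
Variables (K : groupType) (I : Type) (a : I -> K).

Definition in_span : pred K := fun k => `[< range (eval_word a) k >].

(** Turns the generated subgroup into a [groupType], as required of [G]. *)
Record span := Span { span_val : K; _ : in_span span_val }.

HB.instance Definition _ := [isSub for span_val].
HB.instance Definition _ := [Choice of span by <:].

Fact in_span_closed : group_closed in_span.
Proof.
have S := range_eval_word_subgroup a.
split=> [|u v]; rewrite !unfold_in; first exact/asboolT/(subgroup1 S).
by move=> /asboolP Su /asboolP Sv; apply/asboolT/(subgroupF S).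
Qed.

HB.instance Definition _ := SubChoice_isSubGroup.Build K in_span span in_span_closed.

Fact in_span_gen i : in_span (a i).
Proof. by apply/asboolP; exists [:: (i, false)]; rewrite // eval_word_cons eval_word_nil mulg1. Qed.

Definition span_gen i : span := Span (in_span_gen i).

Lemma span_valM : {morph span_val : u v / u * v}.
Proof. exact: valM. Qed.

HB.instance Definition _ := isMultiplicative.Build span K span_val span_valM.

Lemma val_eval_span u : span_val (eval_word span_gen u) = eval_word a u.
Proof. exact: eval_word_morph. Qed.

Lemma span_generated : generates span_gen.
Proof.
apply/seteqP; split=> // -[k kspan] _; have [u _ uE] := asboolP _ kspan.
by exists u => //; apply: val_inj; rewrite /= val_eval_span uE.
Qed.

Lemma range_span_val : range span_val = range (eval_word a).
Proof.
apply/seteqP; split=> [_ [[k kspan] _ <-]|k kspan]; first exact/asboolP.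
by exists (Span (asboolT kspan)).
Qed.

End Span.
(** * The embedding *)

Section Embedding.
Variables (H : groupType) (x : nat -> H).
Let fs := pair_gen (fgen x) (sgen H).

(** The word s^k f s^-k, which represents [f] translated by k. *)
Definition conj_word (k : nat) : word bool :=
  nseq k (true, false) ++ (false, false) :: inv_word (nseq k (true, false)).

(* The commutator of [s f s^-1] and [s ^ K f s ^ -K] for [K = 2 ^ i.+1]: their
   supports only meet at [0], by the parity argument of [pow2_sum1]. *)
Definition gen_word (i : nat) : word bool :=
  conj_word 1 ++ conj_word (2 ^ i.+1) ++ inv_word (conj_word 1)
    ++ inv_word (conj_word (2 ^ i.+1)).

Lemma computable_gen_word : computable gen_word.
Proof.
have nC (k : nat -> nat) : computable k -> computable (fun i => nseq (k i) (true, false)).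
  move=> kC; have -> : (fun i => nseq (k i) (true, false)) =
      (fun i => map (fun=> (true, false)) (iota 0 (k i))).
    apply/funext => i; elim: (k i) 0%N => // n IH j /=; congr (_ :: _); exact: IH.
  by apply: (computable_map (g := fun _ _ => (true, false))); computability.
have wC (k : nat -> nat) : computable k -> computable (fun i => conj_word (k i)).
  by move=> kC; rewrite /conj_word; computability; [apply: nC | apply/computable_inv_word/nC].
have C1 := wC _ (computable_const _ 1%N).
have C2 : computable (fun i => conj_word (2 ^ i.+1)) by apply: wC; computability.
apply: (computable_cat C1); apply: (computable_cat C2).
exact: computable_cat (computable_inv_word C1) (computable_inv_word C2).
Qed.

Lemma sgenX k : sgen H ^+ k = wreath_shift _ k%:Z.
Proof.
elim: k => // k IH; rewrite expgS IH; apply: wreath_eq => [n|].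
  by rewrite wfunM /= mulg1.
by rewrite wshiftM /=; lia.
Qed.

Lemma eval_conj_word k : wshift (eval_word fs (conj_word k)) = 0%R /\
  forall n, eval_word fs (conj_word k) n = fgen_fun x (n + k%:Z)%R.
Proof.
rewrite /conj_word eval_word_cat eval_word_cons eval_inv_word !eval_word_nseq /= sgenX.
by split=> [|n] /=; [lia | rewrite mul1g invg1 mulg1].
Qed.

Definition embed (h : H) : wreath (wreath H) := wdelta (wdelta h).

Lemma embedM : {morph embed : a b / a * b}.
Proof. by move=> a b; rewrite /embed !gmulfM. Qed.

HB.instance Definition _ := isMultiplicative.Build H (wreath (wreath H)) embed embedM.

(** If n is not 0, then n + 1 is an even power of two, so n + 2^(i+1) is odd and hence 1. This makes
    n negative, against n + 1 >= 2. *)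
Lemma pow2_sum1 n i : is_pow2 (n + 1)%R -> is_pow2 (n + (2 ^ i.+1)%N%:Z)%R -> n = 0%R.
Proof.
move=> /is_pow2P[[|a] aE] /is_pow2P[[|b] bE]; rewrite ?expnS in aE bE *; lia.
Qed.

Lemma eval_gen_word i : eval_word fs (gen_word i) = embed (x i).
Proof.
have := eval_conj_word (2 ^ i.+1); have := eval_conj_word 1; rewrite /gen_word.
move: (conj_word 1) (conj_word (2 ^ i.+1)) => a b [u0 uE] [v0 vE].
rewrite !eval_word_cat !eval_inv_word !mulgA.
apply: wreath_eq => [n|]; last by rewrite !wshiftM !wshiftV u0 v0.
rewrite !wreathE u0 v0 !(GRing.addr0, GRing.subr0) uE vE /=.
(* Both translates have shift 0, so the commutator is taken coordinatewise: at 0 it is that of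
   [gamma x 0] and [gamma x i.+1], elsewhere one entry is trivial. *)
case: eqP => [->|n0].
  by rewrite !GRing.add0r fgen_exp (fgen_exp x 0) gamma_comm.
rewrite {2 4}/fgen_fun; case: ifP => [p1|_]; last by rewrite invg1 !mulg1 mulgV.
rewrite /fgen_fun; case: ifP => [p2|_]; first by case: n0; apply: pow2_sum1 p2 p1.
by rewrite mul1g invg1 mulg1 mulgV.
Qed.

Hypothesis x_gen : generates x.

Lemma embed_in_span h : in_span fs (embed h).
Proof.
have [u _ <-] : range (eval_word x) h by rewrite x_gen.
apply/asboolP; exists (subst_word gen_word u) => //.
exact: eval_subst_word eval_gen_word.
Qed.

End Embedding.

(** * Decision problems for [f] and [s], reduced through both levels to [H] *)

Section Decision.
Variables (H : groupType) (x : nat -> H).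
Let fs := pair_gen (fgen x) (sgen H).

Lemma recursive_fs_triv : recursive_in x [set 1] -> recursive_in fs [set 1].
Proof.
move=> t; apply: (recursive_triv (eval_fs_emit x) (zdiff_fs_move x) computable_fs_move
  computable_fs_emit computable_fs_range (@fs_coord_range H x)).
exact: (recursive_triv (eval_gamma_emit x) (zdiff_gamma_move x) computable_gamma_move
  computable_gamma_emit computable_gamma_range (@gamma_coord_range H x)).
Qed.

Lemma semirecursive_fs_triv : semirecursive_in x [set 1] -> semirecursive_in fs [set 1].
Proof.
move=> t; apply: (semirecursive_triv (eval_fs_emit x) (zdiff_fs_move x) computable_fs_move
  computable_fs_emit computable_fs_range (@fs_coord_range H x)).
exact: (semirecursive_triv (eval_gamma_emit x) (zdiff_gamma_move x) computable_gamma_move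
  computable_gamma_emit computable_gamma_range (@gamma_coord_range H x)).
Qed.

Lemma recursive_fs_embed : recursive_in x [set 1] -> recursive_in fs (base_at (base_at setT)).
Proof.
move=> t.
have T : recursive_in x setT by exists (fun=> true); [apply: computable_const | split].
have t1 := recursive_triv (eval_gamma_emit x) (zdiff_gamma_move x) computable_gamma_move
  computable_gamma_emit computable_gamma_range (@gamma_coord_range H x) t.
apply: (recursive_base_at (eval_fs_emit x) (zdiff_fs_move x) computable_fs_move
  computable_fs_emit computable_fs_range (@fs_coord_range H x)) => //.
exact: (recursive_base_at (eval_gamma_emit x) (zdiff_gamma_move x) computable_gamma_move
  computable_gamma_emit computable_gamma_range (@gamma_coord_range H x)).
Qed.

Lemma recursive_fs_cone (P : set H) : left_cone P ->
  recursive_in x [set 1] -> recursive_in x P -> recursive_in fs (wreath_cone (wreath_cone P)).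
Proof.
move=> lP t p; have [P1 _ _ _] := lP; have [WP1 _ _ _] := wreath_cone_left lP.
apply: (recursive_wreath_cone (eval_fs_emit x) (zdiff_fs_move x) computable_fs_move
  computable_fs_emit computable_fs_range (@fs_low H x) (@fs_coord_range H x)) => //.
  exact: (recursive_triv (eval_gamma_emit x) (zdiff_gamma_move x) computable_gamma_move
    computable_gamma_emit computable_gamma_range (@gamma_coord_range H x)).
exact: (recursive_wreath_cone (eval_gamma_emit x) (zdiff_gamma_move x) computable_gamma_move
  computable_gamma_emit computable_gamma_range (@gamma_low H x) (@gamma_coord_range H x)).
Qed.

Lemma range_embed w : range (@embed H) w <-> base_at (base_at setT) w.
Proof.
split=> [[h _ <-]|[w0 w1 [v0 v1 _]]].
  by split=> // [n|] /=; [move/eqP/negbTE-> | split=> // n /eqP/negbTE /= ->].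
have /wdelta_range[h _ hE] : wshift (w 0%R) = 0%R /\ forall n, n <> 0%R -> w 0%R n = 1 by [].
have /wdelta_range[v _ vE] : wshift w = 0%R /\ forall n, n <> 0%R -> w n = 1 by [].
by exists h => //; rewrite /embed hE -vE.
Qed.

End Decision.

(** * The derived length of the group generated by [f] and [s] *)

Section DerivedSeries.
Variables (H : groupType) (x : nat -> H).
Let fs := pair_gen (fgen x) (sgen H).
Hypothesis x_gen : generates x.

(** By [gamma_comm] each generator [x i] is the value at 0 of a commutator, so all of [H] is still
    visible after one derivation. *)
Lemma wproj_gamma :
  [set: H] `<=` wproj (derived_series (range (eval_word (gamma x))) 1).
Proof.
move=> h _; have [u _ <-] : range (eval_word x) h by rewrite x_gen.
have S := range_eval_word_subgroup (gamma x).
apply: eval_word_subgroup => [|i].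
  exact/wproj_subgroup/derived_seriesS_subgroup.
have gammaR j : range (eval_word (gamma x)) (gamma x j).
  by exists [:: (j, false)] => //; rewrite eval_word_cons eval_word_nil mulg1.
exists (wdelta (x i)) => //; rewrite -gamma_comm.
have -> : gamma x 0 * gamma x i.+1 * (gamma x 0)^-1 * (gamma x i.+1)^-1 =
    [~ (gamma x 0)^-1, (gamma x i.+1)^-1] by rewrite /commg /conjg !invgK !mulgA.
by apply: (@derived_series_comm _ _ 0); apply: (subgroupV S).
Qed.

(** For K = 2^j, the commutator of s^K f s^-K with s^K has value f(K)^-1 f(0) at 0, which is the
    inverse of [gamma x j] because f(0) = 1. *)
Lemma wproj_fs :
  range (eval_word (gamma x)) `<=` wproj (derived_series (range (eval_word fs)) 1).
Proof.
move=> _ [v _ <-]; have S := range_eval_word_subgroup fs.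
have D : subgroup (wproj (derived_series (range (eval_word fs)) 1)).
  exact/wproj_subgroup/derived_seriesS_subgroup.
apply: eval_word_subgroup => // j; rewrite -[gamma x j]invgK; apply: (subgroupV D).
have [u0 uE] := eval_conj_word x (2 ^ j).
set u := eval_word _ _ in u0 uE; pose s := sgen H ^+ (2 ^ j).
exists [~ u, s].
  apply: (@derived_series_comm _ _ 0); first by exists (conj_word (2 ^ j)).
  by exists (nseq (2 ^ j) (true, false)); rewrite ?eval_word_nseq.
split; first exact: wshift_comm.
rewrite /commg wfunM wfunV wshiftV u0 !GRing.subr0 wfun_conj // /s sgenX /= conjg1 !uE.
have -> : (0 + - 0 - Posz (2 ^ j)%N + Posz (2 ^ j)%N)%R = 0%R by lia.
have -> : fgen_fun x 0%R = 1 by rewrite /fgen_fun; case: (boolP (is_pow2 _)) => // /is_pow2_gt0.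
by rewrite GRing.add0r fgen_exp mulg1.
Qed.

Lemma wproj_nontrivial (A : groupType) (T : set A) (V : set (wreath A)) a :
  T `<=` wproj V -> T a -> a <> 1 -> exists2 v, V v & v <> 1.
Proof. by move=> TV /TV[v Vv [_ <-]] v1; exists v => // E; apply: v1; rewrite E. Qed.

Lemma span_fs_solvable l :
  solvable_of_derived_length H l -> solvable_of_derived_length (span fs) (l + 2)%N.
Proof.
move=> [Hl Hm]; rewrite addn2.
have valD n : @span_val _ _ fs @` derived (span fs) n = derived_series (range (eval_word fs)) n.
  rewrite -range_span_val; exact: (derived_series_image (@span_val _ _ fs) setT n).
split.
  apply/seteqP; split=> [g Dg|_ ->]; last exact: (subgroup1 (derived_subgroup _ _)).
  have : (@span_val _ _ fs @` derived (span fs) l.+2) (span_val g) by exists g.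
  rewrite valD => /(derived_series_mono (@subsetT _ _)) D.
  (* Each of the two levels uses up one derivation, which leaves entries in [derived H l]. *)
  have [g0 gD] := @derived_wreath _ l.+1 _ D.
  apply: val_inj; apply: wreath_eq => // n.
  have [gn0 gnD] := @derived_wreath _ l _ (gD n).
  by apply: wreath_eq => // m; have := gnD m; rewrite Hl.
have nontriv n : (exists2 v, derived_series (range (eval_word fs)) n v & v <> 1) ->
    derived (span fs) n <> [set 1].
  move=> [v Dv v1] E; apply: v1; move: Dv; rewrite -valD E => -[g -> <-]; exact: multiplicative1.
have eval_gamma0 : range (eval_word (gamma x)) (gamma x 0).
  by exists [:: (0%N, false)] => //; rewrite eval_word_cons eval_word_nil mulg1.
have gamma0 : gamma x 0 <> 1 by move=> /(congr1 (@wshift _)).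
(* Nontriviality before step l + 2: step 0 contains [s], step 1 projects onto [gamma x 0], and step
   m + 2 projects, in two stages, onto a nontrivial element of [derived H m]. *)
case=> [_|[_|m ltm]].
- apply: nontriv; exists (sgen H); last by move=> /(congr1 (@wshift _)).
  by exists [:: (true, false)] => //; rewrite eval_word_cons eval_word_nil mulg1.
- exact/nontriv/(wproj_nontrivial wproj_fs eval_gamma0 gamma0).
apply: nontriv.
have [h Dh h1] : exists2 h, derived H m h & h <> 1.
  apply: contrapT => noh; apply: (Hm m); first by [].
  apply/seteqP; split=> [h Dh|_ ->]; last exact: (subgroup1 (derived_subgroup _ _)).
  by apply: contrapT => h1; apply: noh; exists h.
have D1 := wproj_derived_series (n := m) wproj_gamma.
have [v Dv v1] := wproj_nontrivial D1 Dh h1.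
have D2 := wproj_derived_series (n := m.+1) wproj_fs.
rewrite derived_series_iter addn1 in Dv.
have [w Dw w1] := wproj_nontrivial D2 Dv v1.
by exists w => //; rewrite derived_series_iter addn1 in Dw.
Qed.

End DerivedSeries.

(** * Transfer of cones and decision problems to the generated group *)

Section SpanTransfer.
Variables (K : groupType) (I : countType) (a : I -> K).

Lemma span_eq1 (g : span a) : g = 1 <-> span_val g = 1.
Proof.
split=> [->|g1]; first exact: multiplicative1.
by apply: val_inj; rewrite [LHS]g1; apply/esym/multiplicative1.
Qed.

Lemma eval_span_gen S :
  [set u | S (span_val (eval_word (span_gen a) u))] = [set u | S (eval_word a u)].
Proof. by apply/seteqP; split=> u /=; rewrite val_eval_span. Qed.

Lemma eval_span_gen1 :
  [set u | eval_word (span_gen a) u = 1] = [set u | eval_word a u = 1].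
Proof.
rewrite -(eval_span_gen [set 1]); apply/seteqP.
by split=> u /=; rewrite span_eq1.
Qed.

Lemma left_cone_span (P : set K) :
  left_cone P -> left_cone [set g : span a | P (span_val g)].
Proof.
move=> [P1 PM anti tot]; split.
- exact: P1.
- by move=> g h; apply: PM.
- by move=> g Pg Pg'; apply/span_eq1/anti.
- by move=> g; apply: tot.
Qed.

Lemma bi_cone_span (P : set K) : bi_cone P -> bi_cone [set g : span a | P (span_val g)].
Proof.
move=> [lP PJ]; split; first exact: left_cone_span.
by move=> g h; apply: PJ.
Qed.

(** Comparing u with v means testing u^-1 v for membership in the cone, and a word for it is
    computed from the two words. *)
Lemma computable_order_span (P : set K) : recursive_in a P ->
  computable_order (span_gen a) (order_of [set g : span a | P (span_val g)]).
Proof.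
move=> PR; rewrite /computable_order.
have -> : [set uv : word I * word I | order_of [set g : span a | P (span_val g)]
    (eval_word (span_gen a) uv.1) (eval_word (span_gen a) uv.2)] =
    [set uv | P (eval_word a (inv_word uv.1 ++ uv.2))].
  apply/seteqP; split=> -[u v] /=; rewrite eval_word_cat eval_inv_word -!(val_eval_span a).
    by move/asboolP.
  by move=> Puv; apply/asboolP.
apply: (recursive_set_preimage (f := fun uv : word I * word I => inv_word uv.1 ++ uv.2) _ PR).
by computability; apply: computable_inv_word; computability.
Qed.

End SpanTransfer.

(** By antisymmetry u = 1 iff 1 <= u and u <= 1, so a computable order already solves the word
    problem. *)
Lemma recursive_in_triv (G : groupType) (I : countType) (x : I -> G) (le : rel G) :
  left_order le -> computable_order x le -> recursive_in x [set 1].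
Proof.
move=> [anti _ tot _] [d dC dE]; exists (fun u => d ([::], u) && d (u, [::])).
  by apply: computable_andb; apply: (computable_comp dC);
    apply: computable_pair; computability.
move=> u; split=> [u1|/andP[/dE le1 /dE ge1]].
  by apply/andP; split; apply/dE; rewrite /= eval_word_nil u1; have := tot 1 1; rewrite orbb.
by apply: anti; move: le1 ge1; rewrite /= eval_word_nil => -> ->.
Qed.

Lemma recursive_in_cone (G : groupType) (I : countType) (x : I -> G) (le : rel G) :
  computable_order x le -> recursive_in x (cone_of le).
Proof.
have C : computable (fun u : word I => ([::] : word I, u)).
  by apply: computable_pair; computability.
by move=> /(recursive_set_preimage C); rewrite /= eval_word_nil.
Qed.

(** * The embedding into [G] and the orders on [G] *)

Section SpanEmbed.
Variables (H : groupType) (x : nat -> H).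
Hypothesis x_gen : generates x.
Let fs := pair_gen (fgen x) (sgen H).

Definition span_embed (h : H) : span fs := Span (embed_in_span x_gen h).

Lemma span_embedM : {morph span_embed : a b / a * b}.
Proof. by move=> a b; apply: val_inj; rewrite /= embedM. Qed.

HB.instance Definition _ := isMultiplicative.Build H (span fs) span_embed span_embedM.

Lemma span_embed_inj : injective span_embed.
Proof. by move=> a b /(congr1 (@span_val _ _ _)) /= /wdelta_inj/wdelta_inj. Qed.

Lemma range_span_embed g : range span_embed g <-> base_at (base_at setT) (span_val g).
Proof.
rewrite -range_embed; split=> [[h _ <-]|[h _ hE]]; first by exists h.
by exists h => //; apply: val_inj.
Qed.

(** Lexicographic on both levels: the shift counts first, then the leftmost nontrivial coordinate.
    On the copy of [H] at (0, 0) only the value in [H] is left to compare. *)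
Definition lex_order (le : rel H) : rel (span fs) :=
  order_of [set g : span fs | wreath_cone (wreath_cone (cone_of le)) (span_val g)].

Lemma lex_order_left le : left_order le -> left_order (lex_order le).
Proof.
by move=> /left_cone_of/wreath_cone_left/wreath_cone_left lP; apply/order_of_left/left_cone_span.
Qed.

Lemma lex_order_bi le : bi_order le -> bi_order (lex_order le).
Proof.
by move=> /bi_cone_of/wreath_cone_bi/wreath_cone_bi lP; apply/order_of_bi/bi_cone_span.
Qed.

Lemma lex_order_continues le : left_order le -> continues span_embed le (lex_order le).
Proof.
move=> lo h h'; have [P1 _ _ _] := left_cone_of lo; have [_ _ _ inv] := lo.
have [WP1 _ _ _] := wreath_cone_left (left_cone_of lo).
have -> : lex_order le (span_embed h) (span_embed h') <-> le 1 (h^-1 * h').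
  have E : (span_embed h)^-1 * span_embed h' = span_embed (h^-1 * h').
    by rewrite gmulfM multiplicativeV.
  rewrite /lex_order /order_of E; split.
    by move/asboolP/(wreath_cone_delta _ WP1)/(wreath_cone_delta _ P1).
  by move=> le1; apply/asboolP/(wreath_cone_delta _ WP1)/(wreath_cone_delta _ P1).
split=> [/(inv h^-1)|/(inv h)]; rewrite ?mulVg // mulg1 mulVKg //.
Qed.

Lemma lex_order_computable le : left_order le -> computable_order x le ->
  computable_order (span_gen fs) (lex_order le).
Proof.
move=> lo leC; apply/computable_order_span/recursive_fs_cone.
- exact: left_cone_of.
- exact: recursive_in_triv leC.
- exact: recursive_in_cone.
Qed.

(** * The subnormal chain *)

Definition shift_free : set (span fs) := [set g | wshift (span_val g) = 0%R].
(** These elements are functions from Z x Z to [H], multiplied pointwise; hence the copy of [H] at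
    (0, 0) is normal among them. *)
Definition doubly_shift_free : set (span fs) :=
  [set g | wshift (span_val g) = 0%R /\ forall n, wshift (span_val g n) = 0%R].

Lemma shift_free_subgroup : subgroup shift_free.
Proof.
apply/subgroupP; split=> [|g h]; first by rewrite /shift_free /=.
by rewrite /shift_free /= => -> ->.
Qed.

Lemma doubly_shift_free_subgroup : subgroup doubly_shift_free.
Proof.
apply/subgroupP; split=> [|g h]; first by rewrite /doubly_shift_free /=.
rewrite /doubly_shift_free /= => -[g0 gn] [h0 hn].
by rewrite g0 h0; split=> // n; rewrite gn hn.
Qed.

Lemma range_span_embed_subgroup : subgroup (range span_embed).
Proof. exact/image_subgroup/setT_subgroup. Qed.

Lemma span_embed_normal : normal_in (range span_embed) doubly_shift_free.
Proof.
split; [exact: range_span_embed_subgroup | exact: doubly_shift_free_subgroup | |].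
  move=> _ [h _ <-]; split=> // n; rewrite /= /embed /=.
  by case: eqP.
move=> g k /range_span_embed[g0 g1 [v0 v1 _]] [k0 kn]; apply/range_span_embed.
rewrite multiplicativeJ; split=> [|n n0|]; rewrite ?wshift_conj // wfun_conj // k0 GRing.subr0.
  by rewrite g1 // conj1g.
split=> // [|m m0]; rewrite ?wshift_conj // wfun_conj // kn GRing.subr0.
by rewrite v1 // conj1g.
Qed.

Lemma doubly_shift_free_normal : normal_in doubly_shift_free shift_free.
Proof.
split; [exact: doubly_shift_free_subgroup | exact: shift_free_subgroup | by move=> g [] |].
move=> g k [g0 gn] k0.
have J : span_val (g ^ k) = span_val g ^ span_val k by apply: multiplicativeJ.
split=> [|n]; rewrite J; first by rewrite wshift_conj.
by rewrite wfun_conj // wshift_conj.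
Qed.

Lemma shift_free_normal : normal_in shift_free setT.
Proof.
split; [exact: shift_free_subgroup | exact: setT_subgroup | by [] |].
move=> g k g0 _; have J : span_val (g ^ k) = span_val g ^ span_val k by apply: multiplicativeJ.
suff : wshift (span_val (g ^ k)) = 0%R by [].
by rewrite J wshift_conj.
Qed.

End SpanEmbed.
Theorem theorem3 (H : groupType) (x : nat -> H) (x_gen : generates x) :
  exists (G : groupType) (f s : G) (Phi : {multiplicative H -> G}),
    [/\ injective Phi
      , generates (pair_gen f s)
      & [/\ (* (a) *)
            exists2 w : nat -> word bool, computable w
              & forall i : nat, eval_word (pair_gen f s) (w i) = Phi (x i)
          , (* (b) *)
            forall l : nat,
              solvable_of_derived_length H l ->
              solvable_of_derived_length G (l + 2)%N
          , (* (c) *)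
            recursively_presented (pair_gen f s) <-> recursively_presented x
          , (* (d) *)
            computable_group (pair_gen f s) <-> computable_group x
          & [/\ (* (e) *)
                computable_group x ->
                recursive_set
                  [set u : word bool | range Phi (eval_word (pair_gen f s) u)]
              , (* (f), left-orders *)
                [/\ left_orderable H -> left_orderable G
                  , forall leH : rel H, left_order leH ->
                      exists2 leG : rel G, left_order leG
                        & continues Phi leH leG
                  & forall leH : rel H,
                      left_order leH -> computable_order x leH ->
                      exists leG : rel G,
                        [/\ left_order leG
                          , computable_order (pair_gen f s) leG
                          & continues Phi leH leG]]
              , (* (f), bi-orders *)
                [/\ bi_orderable H -> bi_orderable G
                  , forall leH : rel H, bi_order leH ->
                      exists2 leG : rel G, bi_order leG
                        & continues Phi leH leG
                  & forall leH : rel H,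
                      bi_order leH -> computable_order x leH ->
                      exists leG : rel G,
                        [/\ bi_order leG
                          , computable_order (pair_gen f s) leG
                          & continues Phi leH leG]]
              & (* (g) *)
                (exists N1 N2 : set G,
                   [/\ normal_in (range Phi) N1, normal_in N1 N2
                     & normal_in N2 setT])
                /\ subnormal (range Phi)]]].
Proof.
Proof.
pose fs := pair_gen (fgen x) (sgen H).
have fsE : pair_gen (span_gen fs false) (span_gen fs true) = span_gen fs.
  by apply/funext; case.
have triv_fs : recursively_presented (span_gen fs) = re_set [set u | eval_word fs u = 1].
  by rewrite /recursively_presented eval_span_gen1.
have comp_fs : computable_group (span_gen fs) = recursive_in fs [set 1].
  by rewrite /computable_group eval_span_gen1.
(* Substituting [gen_word i] for [x i] reduces the word problem of [H] to that of [G], which gives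
   the forward directions of (c) and (d). *)
have sub1 u : eval_word fs (subst_word gen_word u) = 1 <-> eval_word x u = 1.
  rewrite (eval_subst_word (f := @embed H) u (eval_gen_word x)).
  split=> [|->]; last exact: (multiplicative1 (@embed H)).
  by rewrite -(multiplicative1 (@embed H)) => /wdelta_inj/wdelta_inj.
exists (span fs), (span_gen fs false), (span_gen fs true), (span_embed x_gen).
rewrite fsE; split; [exact: span_embed_inj | exact: span_generated | split].
- exists gen_word => [|i]; first exact: computable_gen_word.
  by apply: val_inj; rewrite /= val_eval_span eval_gen_word.
- exact: span_fs_solvable.
- rewrite triv_fs; split=> [re|re].
  + apply: (@re_of_semirecursive _ nat x [set 1] id id) => //; first exact: computable_id.
    have [p pC pE] := semirecursive_of_re (S := [set 1]) erefl re.
    exists (fun u c => p (subst_word gen_word u) c) => [|u]; last first.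
      by rewrite -pE /= sub1.
    apply: (computable_comp pC (f := fun q : word nat * nat => (subst_word gen_word q.1, q.2))).
    computability; apply: (computable_comp (computable_subst_word computable_gen_word)).
    by computability.
  + apply: (@re_of_semirecursive _ bool fs [set 1] odd nat_of_bool) => //.
    * exact: (computable_odd (computable_id _)).
    * exact: oddb.
    * exact/semirecursive_fs_triv/semirecursive_of_re.
- rewrite comp_fs; split=> [|xC]; last exact: recursive_fs_triv.
  move=> /(recursive_set_preimage (computable_subst_word computable_gen_word)).
  rewrite /computable_group; congr recursive_set; apply/seteqP.
  by split=> u; rewrite /= sub1.
split.
- move=> xC.
  have -> : [set u | range (span_embed x_gen) (eval_word (span_gen fs) u)] =
      [set u | base_at (base_at setT) (eval_word fs u)].
    rewrite -(eval_span_gen fs (base_at _)).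
    by apply/funext => u; apply/propext/range_span_embed.
  exact: recursive_fs_embed.
- have cont leH : left_order leH ->
      exists2 leG, left_order leG & continues (span_embed x_gen) leH leG.
    move=> lo; exists (@lex_order _ x leH); [exact: lex_order_left | exact: lex_order_continues].
  split=> // [[leH /cont[leG lo _]]|leH lo leC]; first by exists leG.
  exists (@lex_order _ x leH); split.
  + exact: lex_order_left.
  + exact: lex_order_computable.
  + exact: lex_order_continues.
- have cont leH : bi_order leH ->
      exists2 leG, bi_order leG & continues (span_embed x_gen) leH leG.
    move=> lo; exists (@lex_order _ x leH); [exact: lex_order_bi | exact: lex_order_continues lo.1].
  split=> // [[leH /cont[leG lo _]]|leH lo leC]; first by exists leG.
  exists (@lex_order _ x leH); split.
  + exact: lex_order_bi.
  + exact: lex_order_computable lo.1 leC.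
  + exact: lex_order_continues lo.1.
have N0 := span_embed_normal x_gen; have N1 := doubly_shift_free_normal x.
have N2 := shift_free_normal x.
split; first by exists (@doubly_shift_free _ x), (@shift_free _ x).
(* The list has three entries, so the term of index 3 is the default [setT], the whole group. *)
exists 3%N, (nth setT [:: range (span_embed x_gen); @doubly_shift_free _ x; @shift_free _ x]).
by split=> // i; case: i => [|[|[|i]]] //.
Qed.
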